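(* As $K\to\infty$, $$\frac{1}{4K}2^{2K}(1-o(1))\ \le\ F(K)\ \le\ \frac{1}{2K}2^{2K}(1-o(1)),$$ and both bounds are sharp up to the $o(1)$ terms; that is, $\liminf_{K\to\infty}F(K)\,K\,2^{-2K}=\frac14$ and $\limsup_{K\to\infty}F(K)\,K\,2^{-2K}=\frac12$.
   Context: For real $K\ge1$, $$F(K)=\sup\left\{\frac{|\langle A\rangle|}{|A|} : n\in\mathbb{N},\ \varnothing\neq A\subseteq\mathbb{Z}_2^n,\ \frac{|A+A|}{|A|}\le K\right\},$$ where $A+A=\{a+a' : a,a'\in A\}$ and the affine span $\langle A\rangle$ is the smallest coset (of any subgroup of $\mathbb{Z}_2^n$) containing $A$. Here $o(1)$ denotes a quantity tending to $0$ as the real parameter $K\to\infty$. *)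

(* Defs.v *)
(* MathComp / MathComp-Analysis *)
From HB Require Import structures.
From mathcomp Require Import all_boot all_order all_fingroup all_algebra.

Set Implicit Arguments.
Unset Strict Implicit.
Unset Printing Implicit Defensive.

Import GRing.Theory.
Local Open Scope ring_scope.

(* Z_2^n is 'rV['F_2]_n. Its finGroupType structure is the additive one, so   *)
(* {group 'rV['F_2]_n} is the type of subgroups of Z_2^n, and rcosets H _ is  *)
(* the set of translates H + x.                                               *)

Definition is_coset n (C : {set 'rV['F_2]_n}) : bool :=
  [exists H : {group 'rV['F_2]_n}, C \in rcosets H [set: 'rV['F_2]_n]].

(* This is the smallest coset containing A only if A is nonempty (for A empty *)
(* it is empty, hence not a coset); see affine_spanP.                         *)
Definition affine_span n (A : {set 'rV['F_2]_n}) : {set 'rV['F_2]_n} :=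
  \bigcap_(C : {set 'rV['F_2]_n} | is_coset C && (A \subset C)) C.

Definition sumset n (A : {set 'rV['F_2]_n}) : {set 'rV['F_2]_n} :=
  [set a + a' | a in A, a' in A].

Lemma affine_spanP n (A : {set 'rV['F_2]_n}) : A != set0 ->
  [/\ is_coset (affine_span A), A \subset affine_span A &
      forall C : {set 'rV['F_2]_n},
        is_coset C -> A \subset C -> affine_span A \subset C].
Proof.
case/set0Pn=> a aA; split; first 1 last.
- by apply/bigcapsP => C /andP[].
- by move=> C cC AC; apply: bigcap_inf; rewrite cC.
pose H := [group of \bigcap_(K : {group 'rV['F_2]_n} | A \subset (K :* a)%g) K].
apply/existsP; exists H; apply/rcosetsP; exists a; first by rewrite inE.
apply/setP => x; rewrite mem_rcoset; apply/bigcapP/bigcapP => h.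
- move=> K AK; rewrite -mem_rcoset; apply: h; rewrite AK andbT.
  by apply/existsP; exists K; apply/rcosetsP; exists a; rewrite ?inE.
- move=> C /andP[/existsP[K /rcosetsP[y _ ->]] AK].
  have /rcoset_eqP eK := subsetP AK _ aA.
  by rewrite -eK mem_rcoset; apply: h; rewrite eK.
Qed.

From mathcomp Require Import all_classical all_reals all_analysis.
Import numFieldNormedType.Exports.

Local Open Scope classical_set_scope.

(* The supremum is taken in the extended reals, so no boundedness is presumed. *)
Definition F (R : realType) (K : R) : \bar R :=
  ereal_sup [set r : \bar R | exists (n : nat) (A : {set 'rV['F_2]_n}),
    [/\ A != finset.set0,
        (#|sumset A|%:R / #|A|%:R : R) <= K &
        r = (#|affine_span A|%:R / #|A|%:R)%:E]].

(* Main.v *)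
Require Import Defs.
From HB Require Import structures.
From mathcomp Require Import all_boot all_order all_fingroup all_algebra.
From mathcomp Require Import zify ring lra.

(** Both bounds, and their sharpness, follow from two facts about a nonempty
    set A in Z_2^n and a natural number s.
    - If s > 5 and [2|A + A| <= (s + 1)|A|] then [|<A>| / |A| <= 2^s / (s - 5)]
      ([spanning_bound]).
    - The affine basis {0, e_1, ..., e_s} has [|<A>| / |A| = 2^s / (s + 1)] and
      doubling constant at most [s/2 + 1/(s + 1)] ([simplex] and its lemmas).
    Thus F(K) is about [2^s / s] for all K between roughly [s/2] and
    [(s + 1)/2], while [2^(2K) / K] doubles on this range: the scaled quantity
    falls from 1/2 to 1/4 and then jumps back. The limit superior is reached
    along [K = s/2 + 1/(s + 1)], the limit inferior along [K = (s + 1)/2].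

    For the first fact, choose affine coordinates in which A contains 0 and all
    unit vectors of Z_2^n, where n is the dimension of its span. Compressing A
    along a set I of coordinates, that is, replacing its intersection with each
    coset of the coordinate subspace <I> by an initial segment of the binary
    order of the same size, does not enlarge A + A ([sum_dominatedT],
    [compression_sum]). The unit vectors stay in A as soon as A fills more than
    half of <I> ([compressed_unit]). A set fixed by all compressions of this kind
    ([stable]) has a rigid shape. Let G be the largest subspace spanned by the
    first m coordinates that is contained in A. Then A is the union of G and of
    one initial segment A_j in each coset e_j + G, for m <= j < n, and
    |A_i| + |A_j| <= |G| when i and j differ ([card_stable], [card_pair_le]).
    Moreover A + A contains G, the cosets e_j + G and the sums A_i + A_j, which
    lie in distinct cosets ([card_sum_stable]).

    What remains is an inequality between the densities a_j = |A_j| / |G|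
    ([weights_bound]). With t = n - m of them, of sum sigma, it must be shown
    that [1 + sigma] is at least [(s - 5) 2^(t - s)]. The trivial estimate
    |A_i + A_j| >= (|A_i| + |A_j|)/2 is enough unless s = t + 1. In that case
    almost all densities have to be close to 1/2, and this follows from
    |A_i + A_j| >= |G|/2, valid when both densities exceed 1/4
    ([card_sum_part_half]). *)

Set Implicit Arguments.
Unset Strict Implicit.
Unset Printing Implicit Defensive.
Import Order.TTheory GRing.Theory Num.Theory.
Local Open Scope ring_scope.

(** * The binary order on Z_2^n *)

Section BinaryOrder.
Variable n : nat.
Implicit Types (x y z d : 'rV['F_2]_n) (i j : 'I_n).

Definition bit x i := x 0 i != 0.
Definition ofbits (f : 'I_n -> bool) : 'rV['F_2]_n := \row_j (f j)%:R.

Lemma bitD x y i : bit (x + y) i = bit x i (+) bit y i.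
Proof.
rewrite /bit mxE; move: (x 0 i) (y 0 i).
by case=> [[|[|?]] ?] [[|[|?]] ?].
Qed.

Lemma bit0 i : bit 0 i = false.
Proof. by rewrite /bit mxE eqxx. Qed.

Lemma ofbitsE f i : bit (ofbits f) i = f i.
Proof. by rewrite /bit mxE; case: (f i). Qed.

Lemma bit_inj x y : bit x =1 bit y -> x = y.
Proof.
move=> exy; apply/rowP => i; have := exy i; rewrite /bit.
move: (x 0 i) (y 0 i); case=> [[|[|//]] ?] [[|[|//]] ?] //= _; exact/val_inj.
Qed.

Lemma addvv x : x + x = 0.
Proof. by apply: bit_inj => i; rewrite bitD bit0 addbb. Qed.

Lemma addvK x y : x + y + y = x.
Proof. by rewrite -addrA addvv addr0. Qed.

Lemma addvKl x y : x + (x + y) = y.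
Proof. by rewrite addrA addvv add0r. Qed.

Lemma addv_eq0 x y : (x + y == 0) = (x == y).
Proof.
by apply/eqP/eqP => [e|->]; rewrite ?addvv //; rewrite -[x](addvK x y) e add0r.
Qed.

Definition lead i d := bit d i && [forall j : 'I_n, (i < j)%N ==> ~~ bit d j].

Lemma leadP i d :
  reflect (bit d i /\ forall j : 'I_n, (i < j)%N -> bit d j = false) (lead i d).
Proof.
apply: (iffP andP) => -[di]; last first.
  by move=> h; split=> //; apply/forallP => j; apply/implyP => /h ->.
by move/forallP=> h; split=> // j ij; apply/negbTE; move: (h j); rewrite ij.
Qed.

Lemma lead_ex d : d != 0 -> exists i, lead i d.
Proof.
move=> nz.
have [i0 di0] : exists i, bit d i.
  apply/existsP; apply: contraNT nz; rewrite negb_exists => /forallP h.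
  by apply/eqP/bit_inj => i; rewrite bit0; apply/negbTE.
case: (arg_maxnP (fun i : 'I_n => val i) di0) => i di maxi.
exists i; apply/leadP; split=> // j ij; apply/negbTE/negP => dj.
by have := maxi j dj; rewrite /= leqNgt ij.
Qed.

Lemma lead_uniq d i j : lead i d -> lead j d -> i = j.
Proof.
case/leadP=> di hi /leadP[dj hj]; apply/val_inj.
by case: (ltngtP i j) => // [/hi|/hj]; rewrite ?di ?dj.
Qed.

(** The order of binary numerals, read off the leading bit of the sum x + y:
    adding d to x lowers it exactly when x has the leading bit of d
    ([blt_add]), a condition that passes from a sum to one of its summands. *)
Definition blt x y := [exists i, lead i (x + y) && bit y i].

Lemma bltP x y : reflect (exists2 i, lead i (x + y) & bit y i) (blt x y).
Proof.
by apply: (iffP existsP) => [[i /andP[]]|[i li yi]]; exists i; rewrite ?li.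
Qed.

Lemma bltxx x : blt x x = false.
Proof. by apply/bltP => -[i /leadP[]]; rewrite addvv bit0. Qed.

Lemma blt_total x y : x != y -> blt x y || blt y x.
Proof.
rewrite -addv_eq0 => /lead_ex[i li].
have := li => /leadP[]; rewrite bitD => b _; apply/orP.
case yi: (bit y i) b => b; [left|right]; apply/bltP; exists i => //.
  by rewrite addrC.
by rewrite addbF in b.
Qed.

Lemma blt_trans y x z : blt x y -> blt y z -> blt x z.
Proof.
move=> /bltP[i /leadP[xyi hi] yi] /bltP[j /leadP[yzj hj] zj].
have e : x + z = (x + y) + (y + z) by rewrite addrA addvK.
apply/bltP; rewrite e; case: (ltngtP i j) => ij.
- exists j => //; apply/leadP; split=> [|k jk]; rewrite bitD.
    by rewrite (hi j ij) yzj.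
  by rewrite hj // hi // (ltn_trans ij).
- exists i.
    apply/leadP; split=> [|k ik]; rewrite bitD.
      by rewrite xyi (hj i ij).
    by rewrite hi // hj // (ltn_trans ij).
  by have := hj i ij; rewrite bitD yi; case: (bit z i).
- by move/val_inj: ij zj yzj => <- zi; rewrite bitD yi zi.
Qed.
End BinaryOrder.

(** * Cosets of coordinate subspaces and compressions *)

Section Compression.
Variable n : nat.
Implicit Types (x y z d r u v : 'rV['F_2]_n) (i j : 'I_n) (I J : {set 'I_n}).
Implicit Types (A B C D X Y : {set 'rV['F_2]_n}).

Lemma blt_add i d x : lead i d -> blt (x + d) x = bit x i.
Proof.
move=> li; apply/bltP/idP => [[j]|xi].
  by rewrite [x + d + x]addrC addvKl => /lead_uniq/(_ li) ->.
by exists i => //; rewrite [x + d + x]addrC addvKl.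
Qed.

Definition proj I x : 'rV['F_2]_n := ofbits (fun i => (i \notin I) && bit x i).

Lemma bit_proj I x i : bit (proj I x) i = (i \notin I) && bit x i.
Proof. exact: ofbitsE. Qed.

Lemma projD I x y : proj I (x + y) = proj I x + proj I y.
Proof.
by apply: bit_inj => i; rewrite !(bit_proj, bitD); case: (i \in I).
Qed.

Lemma projK I x : proj I (proj I x) = proj I x.
Proof. by apply: bit_inj => i; rewrite !bit_proj; case: (i \in I). Qed.

Lemma proj_eqP I x y :
  reflect (forall i, i \notin I -> bit x i = bit y i) (proj I x == proj I y).
Proof.
apply: (iffP eqP) => [e i iI | h].
  by have := congr1 (fun w => bit w i) e; rewrite !bit_proj iI.
by apply: bit_inj => i; rewrite !bit_proj; case: (boolP (i \in I)) => // /h ->.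
Qed.

(** These are the cosets of the subspace spanned by the coordinates in I,
    labelled by their representative that vanishes on I; hence the hypothesis
    [proj I r = r] in the counting lemmas, without which the set is empty. *)
Definition fiber I r : {set 'rV['F_2]_n} := [set x | proj I x == r].

Lemma proj_fiber I x r : x \in fiber I r -> proj I x = r.
Proof. by rewrite inE => /eqP. Qed.

Definition msum A B : {set 'rV['F_2]_n} := [set a + b | a in A, b in B].

Lemma msumP A B x :
  reflect (exists u v, [/\ u \in A, v \in B & x = u + v]) (x \in msum A B).
Proof.
by apply: (iffP imset2P) => [[u v uA vB ->]|[u [v [uA vB ->]]]];
  [exists u, v | exists u v].
Qed.

Lemma mem_msum A B u v : u \in A -> v \in B -> u + v \in msum A B.
Proof. by move=> uA vB; apply/msumP; exists u, v. Qed.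

Lemma msumC A B : msum A B = msum B A.
Proof.
by apply/setP => x; apply/msumP/msumP => -[u [v [? ? ->]]];
  exists v, u; rewrite addrC.
Qed.

Lemma msumS A B C D : A \subset C -> B \subset D -> msum A B \subset msum C D.
Proof.
move=> /subsetP AC /subsetP BD; apply/subsetP => _ /msumP[u [v [uA vB ->]]].
by apply: mem_msum; [apply: AC | apply: BD].
Qed.

Lemma card_msuml A B v : v \in B -> (#|A| <= #|msum A B|)%N.
Proof.
move=> vB; rewrite -(card_imset (mem A) (addIr v)); apply: subset_leq_card.
by apply/subsetP => _ /imsetP[u uA ->]; apply: mem_msum.
Qed.

Lemma msum_fiber I r1 r2 X Y :
  X \subset fiber I r1 -> Y \subset fiber I r2 -> msum X Y \subset fiber I (r1 + r2).
Proof.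
move=> /subsetP Xr /subsetP Yr; apply/subsetP => _ /msumP[u [v [uX vY ->]]].
by rewrite inE projD (proj_fiber (Xr _ uX)) (proj_fiber (Yr _ vY)).
Qed.

Lemma card_fibers I A : #|A| = (\sum_r #|A :&: fiber I r|)%N.
Proof.
rewrite -sum1_card (partition_big (proj I) predT) //=; apply: eq_bigr => r _.
by rewrite -sum1_card; apply: eq_bigl => x; rewrite !inE.
Qed.

(** Being an initial segment of the binary order in every coset of the
    coordinate subspace of I. *)
Definition compressed I A :=
  [forall x in A, forall y, (proj I x == proj I y) && blt y x ==> (y \in A)].

Lemma compressedP I A :
  reflect (forall x y, x \in A -> proj I x = proj I y -> blt y x -> y \in A)
          (compressed I A).
Proof.
apply: (iffP forall_inP) => [h x y xA e yx | h x xA].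
  by have := forallP (h x xA) y; rewrite e eqxx yx.
by apply/forallP => y; apply/implyP => /andP[/eqP e]; apply: h.
Qed.

Lemma compressedPn I A :
  ~~ compressed I A ->
  exists x y, [/\ x \in A, y \notin A, proj I x = proj I y & blt y x].
Proof.
rewrite negb_forall_in => /exists_inP[x xA]; rewrite negb_forall.
case/existsP=> y; rewrite negb_imply => /andP[/andP[/eqP e yx] yA].
by exists x, y.
Qed.

(** If c = u + v and c' < c, the leading bit of d = c + c' is set in c, hence in u
    or in v; adding d to that summand alone lowers it and turns the sum into
    c'. *)
Lemma compressed_msum I C D :
  compressed I C -> compressed I D -> compressed I (msum C D).
Proof.
move=> /compressedP hC /compressedP hD; apply/compressedP => c c'.
case/msumP=> u [v [uC vD ->]] e lt.
set d := u + v + c'.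
have c'E : c' = u + v + d by rewrite /d addvKl.
have prd : proj I d = 0 by rewrite /d projD e addvv.
have nz : d != 0.
  by apply: contraTneq lt => d0; rewrite c'E d0 addr0 bltxx.
have [i li] := lead_ex nz.
move: lt; rewrite c'E (blt_add _ li) bitD => b.
have [ui|ui] := boolP (bit u i).
  rewrite addrAC; apply: mem_msum => //; apply: (hC u) => //.
    by rewrite projD prd addr0.
  by rewrite (blt_add _ li).
rewrite -addrA; apply: mem_msum => //; apply: (hD v) => //.
  by rewrite projD prd addr0.
by rewrite (blt_add _ li); move: b; rewrite (negbTE ui).
Qed.

Lemma compressed_fiber I C r : compressed I C -> compressed I (C :&: fiber I r).
Proof.
move=> /compressedP hC; apply/compressedP => x y.
rewrite !inE => /andP[xC xr] e yx.
by rewrite -e xr andbT (hC x).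
Qed.

Lemma compressed_chain I r X Y :
  X \subset fiber I r -> Y \subset fiber I r -> compressed I X -> compressed I Y ->
  (#|X| <= #|Y|)%N -> X \subset Y.
Proof.
move=> /subsetP Xr /subsetP Yr /compressedP hX /compressedP hY le.
apply/subsetP => x xX; apply/negP => /negP xY.
have YX : Y \subset X :\ x.
  apply/subsetP => y yY; have nxy : y != x by apply: contraNneq xY => <-.
  have e : proj I x = proj I y by rewrite (proj_fiber (Xr _ xX)) (proj_fiber (Yr _ yY)).
  rewrite !inE nxy; case/orP: (blt_total nxy) => lt.
    exact: (hX x).
  by rewrite (hY y x) in xY.
have := subset_leq_card YX; rewrite leqNgt (leq_trans _ le) //.
by rewrite (cardsD1 x X) xX.
Qed.

Lemma compressed_uniq I r X Y :
  X \subset fiber I r -> Y \subset fiber I r -> compressed I X -> compressed I Y ->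
  #|X| = #|Y| -> X = Y.
Proof.
move=> Xr Yr cX cY e; apply/eqP; rewrite eqEsubset.
by apply/andP; split; apply: (@compressed_chain I r); rewrite // e.
Qed.

Definition position x := #|[set z | blt z x]|.

Lemma position_lt x y : blt y x -> (position y < position x)%N.
Proof.
move=> yx; apply: proper_card; apply/properP; split.
  by apply/subsetP => z; rewrite !inE => zy; apply: blt_trans zy yx.
by exists y; rewrite inE ?bltxx.
Qed.

(** Compressed sets are found by minimising this quantity, which drops whenever
    an element is exchanged for a missing smaller one of the same coset. *)
Definition potential A := (\sum_(x in A) position x)%N.

Definition same_fibers I A C := [forall r, #|A :&: fiber I r| == #|C :&: fiber I r|].

Lemma same_fibersP I A C :
  reflect (forall r, #|A :&: fiber I r| = #|C :&: fiber I r|) (same_fibers I A C).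
Proof. by apply: (iffP forallP) => h r; apply/eqP. Qed.

Lemma same_fibers_card I A C : same_fibers I A C -> #|A| = #|C|.
Proof.
by move/same_fibersP=> h; rewrite !(card_fibers I); apply: eq_bigr.
Qed.

Lemma swap_same_fibers I A x y : x \in A -> y \notin A -> proj I x = proj I y ->
  same_fibers I A (y |: A :\ x).
Proof.
move=> xA yA e; apply/same_fibersP => r.
have [xr|xr] := eqVneq (proj I x) r.
  have -> : (y |: A :\ x) :&: fiber I r = y |: ((A :&: fiber I r) :\ x).
    apply/setP => z; rewrite !inE; case: (eqVneq z y) => [->|_] /=.
      by rewrite -e xr eqxx.
    by rewrite andbA.
  rewrite cardsU1 !inE (negbTE yA) andbF /= (cardsD1 x (A :&: fiber I r)).
  by rewrite !inE xA xr eqxx.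
congr #|pred_of_set _|; apply/setP => z; rewrite !inE.
case: (eqVneq z y) => [->|_] /=; first by rewrite -e (negbTE xr) andbF.
by case: (eqVneq z x) => [->|_] //=; rewrite (negbTE xr) andbF.
Qed.

Lemma swap_potential A x y : x \in A -> y \notin A -> blt y x ->
  (potential (y |: A :\ x) < potential A)%N.
Proof.
move=> xA yA yx; rewrite /potential big_setU1 /=; last first.
  by rewrite !inE (negbTE yA) andbF.
by rewrite (big_setD1 x xA) /= ltn_add2r position_lt.
Qed.

(** Among the sets with the same number of elements as A in each coset, one of
    least potential is compressed, since otherwise an exchange would lower its
    potential. The strict inequality makes repeated compression terminate. *)
Lemma compression_ex I A : exists C,
  [/\ same_fibers I A C, compressed I C, (potential C <= potential A)%N &
      ~~ compressed I A -> (potential C < potential A)%N].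
Proof.
have AA : same_fibers I A A by apply/same_fibersP.
case: (@arg_minnP _ A (same_fibers I A) potential AA) => C sC minC.
have cC : compressed I C.
  apply/negPn/negP => /compressedPn[x [y [xC yC e yx]]].
  suff /minC : same_fibers I A (y |: C :\ x) by rewrite leqNgt swap_potential.
  apply/same_fibersP => r; rewrite (same_fibersP _ _ _ sC).
  exact/same_fibersP/swap_same_fibers.
exists C; split=> //; first exact: minC.
case/compressedPn=> x [y [xA yA e yx]].
by apply: leq_ltn_trans (minC _ _) (swap_potential xA yA yx); apply: swap_same_fibers.
Qed.

Definition unit_vec i : 'rV['F_2]_n := ofbits (pred1 i).

Lemma bit_unit i j : bit (unit_vec i) j = (j == i).
Proof. exact: ofbitsE. Qed.

Lemma unit_vec_inj : injective unit_vec.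
Proof.
move=> k l e; have := bit_unit k k.
by rewrite e bit_unit eqxx => /eqP.
Qed.

Lemma unit_vec_neq0 k : 0 != unit_vec k.
Proof. by apply/eqP => e; have := bit_unit k k; rewrite -e bit0 eqxx. Qed.

Lemma lead_unit i : lead i (unit_vec i).
Proof.
apply/leadP; rewrite bit_unit eqxx; split=> // k ik.
by rewrite bit_unit; apply/eqP => e; rewrite e ltnn in ik.
Qed.

Lemma lead_unit2 i j : (i < j)%N -> lead j (unit_vec i + unit_vec j).
Proof.
move=> ij; apply/leadP; split=> [|k jk]; rewrite bitD !bit_unit.
  by rewrite eqxx addbT; apply/eqP => e; rewrite e ltnn in ij.
by rewrite -!val_eqE /= !gtn_eqF // (ltn_trans ij).
Qed.

Definition topmost i I := (i \in I) && [forall j in I, (j <= i)%N].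

Lemma topmostP i I :
  reflect (i \in I /\ forall j, j \in I -> (j <= i)%N) (topmost i I).
Proof.
by apply: (iffP andP) => -[iI h]; split=> //; [exact/forall_inP | exact/forall_inP].
Qed.

Lemma topmost_ex i I : i \in I -> exists j, topmost j I.
Proof.
move=> iI; case: (arg_maxnP (fun i : 'I_n => val i) iI) => j jI maxj.
by exists j; apply/topmostP.
Qed.

Lemma proj_unit I i : i \in I -> proj I (unit_vec i) = 0.
Proof.
move=> iI; apply: bit_inj => j; rewrite bit_proj bit_unit bit0.
by case: (eqVneq j i) => [->|]; rewrite ?iI ?andbF.
Qed.

Lemma proj_unit_out I i : i \notin I -> proj I (unit_vec i) = unit_vec i.
Proof.
move=> iI; apply: bit_inj => j; rewrite bit_proj bit_unit.
by case: (eqVneq j i) => [->|]; rewrite ?iI ?andbF.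
Qed.

Lemma fiber_half I i r x : i \in I -> proj I r = r ->
  (x \in fiber (I :\ i) r) = (x \in fiber I r) && ~~ bit x i.
Proof.
move=> iI rr; rewrite !inE.
have r' : proj (I :\ i) r = r.
  apply: bit_inj => j; rewrite -{}rr !bit_proj !inE.
  by case: (j \in I) => /=; rewrite ?andbF.
have ri : bit r i = false by rewrite -rr bit_proj iI.
rewrite -{1}r' -{2}rr; apply/proj_eqP/andP => [h|[/proj_eqP h xi] j].
  split; last by rewrite h ?ri // !inE eqxx.
  by apply/proj_eqP => j jI; apply: h; rewrite !inE negb_and jI orbT.
rewrite !inE negb_and negbK => /orP[/eqP->|/h //].
by rewrite ri (negbTE xi).
Qed.

Lemma fiber_half_sub I i r : i \in I -> proj I r = r ->
  fiber (I :\ i) r \subset fiber I r.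
Proof. by move=> iI rr; apply/subsetP => x; rewrite fiber_half // => /andP[]. Qed.

Lemma card_fiber_half I i r : i \in I -> proj I r = r ->
  #|fiber I r| = (#|fiber (I :\ i) r|).*2.
Proof.
move=> iI rr; set H := fiber (I :\ i) r.
pose H' := [set x + unit_vec i | x in H].
have bitH' x : x \in H -> x \in fiber I r /\ bit x i = false.
  by rewrite /H fiber_half // => /andP[? /negbTE].
have -> : fiber I r = H :|: H'.
  apply/setP => x; rewrite in_setU; apply/idP/orP => [xr|[/bitH'[] //|]].
  - have [xi|xi] := boolP (bit x i); [right | left].
      apply/imsetP; exists (x + unit_vec i); last by rewrite addvK.
      rewrite /H fiber_half // bitD bit_unit eqxx xi andbT.
      by move: xr; rewrite !inE projD proj_unit // addr0.
    by rewrite /H fiber_half // xr xi.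
  - case/imsetP=> y /bitH'[yr _] ->.
    by move: yr; rewrite !inE projD proj_unit // addr0.
rewrite cardsU (_ : H :&: H' = set0) ?cards0 ?subn0.
  by rewrite card_imset ?addnn //; apply: addIr.
apply/setP => x; rewrite in_setI in_set0; apply/negP => /andP[/bitH'[_ xi]].
case/imsetP=> y /bitH'[_ yi] e.
by move: xi; rewrite e bitD bit_unit yi eqxx.
Qed.

Lemma card_fiber I r : proj I r = r -> #|fiber I r| = (2 ^ #|I|)%N.
Proof.
move: {2}#|I| (erefl #|I|) => k; elim: k I => [|k IH] I cI rr.
  have I0 : I = set0 by apply/eqP; rewrite -cards_eq0 cI.
  rewrite cI expn0; apply/eqP/cards1P; exists r; apply/setP => x.
  rewrite !inE -{1}rr; apply/proj_eqP/eqP => [h|-> //].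
  by apply: bit_inj => i; apply: h; rewrite I0 inE.
have /card_gt0P[i iI] : (0 < #|I|)%N by rewrite cI.
have cI' : #|I :\ i| = k by have := cardsD1 i I; rewrite iI cI => -[].
rewrite (card_fiber_half iI rr) IH //; first by rewrite cI cI' expnS mul2n.
apply: bit_inj => j; rewrite -{}rr !bit_proj !inE.
by case: (j \in I) => /=; rewrite ?andbF.
Qed.

Lemma half_compressed I i r : topmost i I -> proj I r = r ->
  compressed I (fiber (I :\ i) r).
Proof.
case/topmostP=> iI top rr; apply/compressedP => x y.
rewrite (fiber_half x iI rr) (fiber_half y iI rr) => /andP[xr xi] e /bltP[j lj xj].
have yr : y \in fiber I r by move: xr; rewrite !inE e.
rewrite yr /=; apply/negP => yi.
suff ij : i = j by rewrite ij xj in xi.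
have [xyj hj] := leadP _ _ lj; apply/val_inj.
have jI : j \in I.
  apply/negPn/negP => jI; move/eqP/proj_eqP: e => /(_ j jI) e.
  by move: xyj; rewrite bitD e addbb.
apply/eqP; rewrite eqn_leq top // andbT leqNgt; apply/negP => /hj.
by rewrite bitD yi (negbTE xi).
Qed.
End Compression.

(** * Compressions do not enlarge sumsets *)

Section Sums.
Variable n : nat.
Implicit Types (x y z d r u v : 'rV['F_2]_n) (i j : 'I_n) (I J : {set 'I_n}).
Implicit Types (A B C D X Y : {set 'rV['F_2]_n}).

(** For z in the target coset, X and z + Y lie in the same coset, which is too
    small to hold them disjointly. *)
Lemma pigeonhole_fiber I r1 r2 X Y : proj I r1 = r1 -> proj I r2 = r2 ->
  X \subset fiber I r1 -> Y \subset fiber I r2 -> (2 ^ #|I| < #|X| + #|Y|)%N ->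
  fiber I (r1 + r2) \subset msum X Y.
Proof.
move=> e1 e2 /subsetP Xr /subsetP Yr big; apply/subsetP => z zr.
pose Yz := [set y + z | y in Y].
have cYz : #|Yz| = #|Y| by rewrite card_imset //; apply: addIr.
have : (#|X :|: Yz| <= 2 ^ #|I|)%N.
  rewrite -(card_fiber e1); apply: subset_leq_card; rewrite subUset.
  apply/andP; split; first exact/subsetP.
  apply/subsetP => _ /imsetP[y /Yr yr ->]; rewrite inE projD (proj_fiber yr).
  by rewrite (proj_fiber zr) [r1 + r2]addrC addvKl.
rewrite leqNgt => /negP le.
have /set0Pn[x] : X :&: Yz != set0.
  apply/negP => /eqP e; apply: le.
  by rewrite cardsU e cards0 subn0 cYz.
rewrite inE => /andP[xX /imsetP[y yY e]].
apply/msumP; exists x, y; split=> //.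
by rewrite e addrC addvKl.
Qed.

(** Inside single cosets, initial segments have the smallest sumset among sets of
    prescribed sizes. Here X' and Y' are the initial segments. *)
Definition sum_dominated I := forall r1 r2 X X' Y Y',
  proj I r1 = r1 -> proj I r2 = r2 ->
  X \subset fiber I r1 -> X' \subset fiber I r1 ->
  Y \subset fiber I r2 -> Y' \subset fiber I r2 ->
  compressed I X' -> compressed I Y' -> #|X| = #|X'| -> #|Y| = #|Y'| ->
  (#|msum X' Y'| <= #|msum X Y|)%N.

(** Each coset meets C + D in an initial segment. If u + v is the largest element
    of this segment, the sum of the two initial segments of C and D around u and
    v is an initial segment containing u + v, hence the whole of it. So a single
    pair of cosets accounts for the count on the left, and the corresponding
    pair of fibres of A and B produces at least as many sums. *)
Lemma compression_sum I A B C D : sum_dominated I ->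
  compressed I C -> compressed I D -> same_fibers I A C -> same_fibers I B D ->
  (#|msum C D| <= #|msum A B|)%N.
Proof.
move=> domI cC cD /same_fibersP AC /same_fibersP BD.
rewrite !(card_fibers I); apply: leq_sum => r _.
set S := msum C D :&: fiber I r.
have [->|/set0Pn[c0 c0S]] := eqVneq S set0; first by rewrite cards0.
case: (@arg_maxnP _ c0 (mem S) (@position n) c0S) => c cS maxc.
have : c \in S by []. rewrite in_setI => /andP[/msumP[u [v [uC vD cE]]] cr].
pose T A u := A :&: fiber I (proj I u).
have sub w E : T E w \subset fiber I (proj I w) by apply: subsetIr.
have SCD : S \subset msum (T C u) (T D v).
  have cCD : compressed I (msum (T C u) (T D v)).
    by apply: compressed_msum; apply: compressed_fiber.
  have cT : c \in msum (T C u) (T D v).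
    by rewrite cE; apply: mem_msum; rewrite !inE ?uC ?vD eqxx.
  apply/subsetP => x xS; have [->//|nxc] := eqVneq x c.
  have e : proj I c = proj I x.
    by move: xS; rewrite inE => /andP[_ /proj_fiber ->]; rewrite (proj_fiber cr).
  case/orP: (blt_total nxc) => lt; first exact: (compressedP _ _ cCD c).
  by have := maxc x xS; rewrite /= leqNgt position_lt.
apply: leq_trans (subset_leq_card SCD) _.
apply: (@leq_trans #|msum (T A u) (T B v)|).
  apply: (domI (proj I u) (proj I v)); rewrite ?projK ?sub //.
  - exact: compressed_fiber.
  - exact: compressed_fiber.
  - exact: AC.
  - exact: BD.
apply: subset_leq_card; rewrite subsetI msumS ?subsetIl //=.
by rewrite -(proj_fiber cr) cE projD msum_fiber.
Qed.

(** An initial segment filling half of a coset is itself a coset, of the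
    hyperplane of <I> where the topmost bit vanishes. Adding to it a segment of
    at most half size stays inside such a half, which already has |X| elements;
    if Y has more than half size, X + Y is everything by the pigeonhole
    principle. *)
Lemma sum_dominated_half I i r1 r2 X X' Y Y' : topmost i I ->
  proj I r1 = r1 -> proj I r2 = r2 ->
  X \subset fiber I r1 -> X' \subset fiber I r1 ->
  Y \subset fiber I r2 -> Y' \subset fiber I r2 ->
  compressed I X' -> compressed I Y' -> #|X| = #|X'| -> #|Y| = #|Y'| ->
  #|X| = #|fiber (I :\ i) r1| ->
  (#|msum X' Y'| <= #|msum X Y|)%N.
Proof.
move=> topi e1 e2 Xr Xr' Yr Yr' cX' cY' eX eY cX.
have iI : i \in I by case/topmostP: topi.
have e12 : proj I (r1 + r2) = r1 + r2 by rewrite projD e1 e2.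
have cH r : proj I r = r -> #|fiber (I :\ i) r| = (2 ^ #|I|)./2.
  by move=> rr; rewrite -(card_fiber rr) (card_fiber_half iI rr) doubleK.
have [small|big] := leqP #|Y| (2 ^ #|I|)./2; last first.
  apply: leq_trans (subset_leq_card (pigeonhole_fiber e1 e2 Xr Yr _)).
    exact: subset_leq_card (msum_fiber Xr' Yr').
  have E : (2 ^ #|I| = (2 ^ #|I|)./2.*2)%N.
    by rewrite -(card_fiber e1) (card_fiber_half iI e1) doubleK.
  by rewrite cX cH // {1}E -addnn ltn_add2l.
have [Y0|/set0Pn[y yY]] := eqVneq Y set0.
  have -> : Y' = set0 by apply/eqP; rewrite -cards_eq0 -eY Y0 cards0.
  rewrite (_ : msum X' set0 = set0) ?cards0 //.
  by apply/setP => x; rewrite in_set0; apply/msumP => -[? [? []]]; rewrite inE.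
apply: leq_trans (card_msuml X yY); rewrite cX cH // -(cH _ e12).
apply: subset_leq_card.
have half r : topmost i I -> proj I r = r -> _ := @half_compressed n I i r.
have H1 : X' \subset fiber (I :\ i) r1.
  apply: (@compressed_chain n I r1); rewrite ?half ?fiber_half_sub //.
  by rewrite -eX cX.
have H2 : Y' \subset fiber (I :\ i) r2.
  apply: (@compressed_chain n I r2); rewrite ?half ?fiber_half_sub //.
  by rewrite -eY cH.
exact: msum_fiber.
Qed.

(** Suppose x is in X, y is not, and y < x in the same coset. If x and y agreed
    at some i in I, compression along the other coordinates would put y in X; so
    they are complementary on I. Thus y is determined by x and conversely.
    As the topmost bit is set in x only, every vector of the lower half other
    than y is in X, and no vector of the upper half other than x is: X is the
    lower half with y exchanged for x. *)
Lemma almost_compressed_card I r X : proj I r = r ->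
  X \subset fiber I r -> (forall i, i \in I -> compressed (I :\ i) X) ->
  ~~ compressed I X ->
  exists2 i, topmost i I & #|X| = #|fiber (I :\ i) r|.
Proof.
move=> rr /subsetP Xr cX /compressedPn[x [y [xX yX e yx]]].
have antip u v : u \in X -> v \notin X -> v \in fiber I r -> blt v u ->
    forall i, i \in I -> bit v i = ~~ bit u i.
  move=> uX vX vr vu i iI.
  have [|nb] := eqVneq (bit v i) (bit u i); last first.
    by move: nb; case: (bit v i); case: (bit u i).
  move=> b; suff vX' : v \in X by rewrite vX' in vX.
  apply: (compressedP _ _ (cX i iI) u) => //.
  apply/eqP/proj_eqP => j; rewrite !inE negb_and negbK => /orP[/eqP-> //|].
  by apply/proj_eqP; rewrite (proj_fiber vr) (proj_fiber (Xr _ uX)).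
have uniqv u v w : u \in X -> v \notin X -> w \notin X -> v \in fiber I r ->
    w \in fiber I r -> blt v u -> blt w u -> v = w.
  move=> uX vX wX vr wr vu wu; apply: bit_inj => i.
  have [iI|] := boolP (i \in I); first by rewrite (antip u v) // (antip u w).
  by apply/proj_eqP; rewrite (proj_fiber vr) (proj_fiber wr).
have uniqu u w v : u \in X -> w \in X -> v \notin X -> v \in fiber I r ->
    blt v u -> blt v w -> u = w.
  move=> uX wX vX vr vu vw; apply: bit_inj => i.
  have [iI|] := boolP (i \in I).
    by apply: negb_inj; rewrite -(antip u v) // -(antip w v).
  by apply/proj_eqP; rewrite (proj_fiber (Xr _ uX)) (proj_fiber (Xr _ wX)).
have xr := Xr _ xX.
have yr : y \in fiber I r by rewrite inE -e (proj_fiber xr).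
have [i0 i0I] : exists i, i \in I.
  have /bltP[i /leadP[xyi _] _] := yx; exists i.
  apply/negPn/negP => iI; move/eqP/proj_eqP: e => /(_ i iI) e.
  by move: xyi; rewrite bitD e addbb.
have [i topi] := topmost_ex i0I; exists i => //.
have /topmostP[iI maxi] := topi.
have above z w : z \in fiber I r -> w \in fiber I r -> ~~ bit z i -> bit w i ->
    blt z w.
  move=> zr wr zi wi; apply/bltP; exists i => //; apply/leadP.
  split=> [|j ij]; first by rewrite bitD wi (negbTE zi).
  have jI : j \notin I by apply/negP => /maxi; rewrite leqNgt ij.
  have /proj_eqP/(_ j jI) : proj I z == proj I w by rewrite (proj_fiber zr) (proj_fiber wr).
  by rewrite bitD => ->; rewrite addbb.
have yi_xi : bit y i = ~~ bit x i by apply: (antip x y).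
have xi : bit x i.
  have [//|xi] := boolP (bit x i).
  have xy : blt x y by apply: above; rewrite // yi_xi xi.
  by have := blt_trans xy yx; rewrite bltxx.
have yi : ~~ bit y i by rewrite yi_xi xi.
have HyX : fiber (I :\ i) r :\ y = X :\ x.
  apply/setP => z; rewrite !in_setD1 fiber_half //.
  apply/andP/andP => [[zy /andP[zr zi]]|[zx zX]].
    split; first by apply: contraNneq zi => ->.
    apply/negPn/negP => zX; case/negP: zy; apply/eqP.
    by apply: (uniqv x) => //; apply: above.
  have zr := Xr _ zX; split; first by apply: contraNneq yX => <-.
  rewrite zr /=; apply: contraNN zx => zi; apply/eqP.
  by apply: (uniqu z x y) => //; apply: above.
by rewrite (cardsD1 x) xX -HyX [RHS](cardsD1 y) fiber_half // yr yi.
Qed.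

(** By induction on I, compressing a pair (X, Y) along all coordinates of I but
    one does not enlarge X + Y. A pair of least total potential is fixed by
    these compressions. Either it consists of initial segments, or one of its
    members has exactly half the size of the coset, and then only sizes
    matter. *)
Lemma sum_dominatedT I : sum_dominated I.
Proof.
move: {2}#|I|.+1 (ltnSn #|I|) => k; elim: k I => // k IH I ltI.
move=> r1 r2 X X' Y Y' e1 e2 Xr Xr' Yr Yr' cX' cY' eX eY.
pose P (p : {set 'rV['F_2]_n} * {set 'rV['F_2]_n}) :=
  [&& p.1 \subset fiber I r1, p.2 \subset fiber I r2, #|p.1| == #|X|,
      #|p.2| == #|Y| & (#|msum p.1 p.2| <= #|msum X Y|)%N].
have P0 : P (X, Y) by rewrite /P /= Xr Yr !eqxx leqnn.
case: (@arg_minnP _ (X, Y) P (fun p => potential p.1 + potential p.2)%N P0) => -[X1 Y1].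
case/and5P => /= X1r Y1r /eqP cX1 /eqP cY1 le minP.
apply: leq_trans (le).
have same_fibers_sub J r A C : proj I r = r -> J \subset I -> same_fibers J A C ->
    A \subset fiber I r -> C \subset fiber I r.
  move=> rr JI /same_fibersP AC /subsetP Ar; apply/subsetP => c cC.
  have /card_gt0P[a] : (0 < #|A :&: fiber J (proj J c)|)%N.
    by rewrite AC; apply/card_gt0P; exists c; rewrite !inE cC eqxx.
  rewrite inE => /andP[/Ar aA /proj_fiber e]; rewrite inE -(proj_fiber aA).
  apply/eqP/esym/eqP/proj_eqP => j jI; move/eqP/proj_eqP: e; apply.
  by apply: contraNN jI; apply: (subsetP JI).
have sub_compressed i : i \in I -> compressed (I :\ i) X1 && compressed (I :\ i) Y1.
  move=> iI; have [C [sC cC pC ltC]] := compression_ex (I :\ i) X1.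
  have [D [sD cD pD ltD]] := compression_ex (I :\ i) Y1.
  have PCD : P (C, D).
    rewrite /P /= -(same_fibers_card sC) -(same_fibers_card sD) cX1 cY1 !eqxx /=.
    rewrite (same_fibers_sub _ _ _ _ _ _ sC X1r) ?subD1set //.
    rewrite (same_fibers_sub _ _ _ _ _ _ sD Y1r) ?subD1set //=.
    apply: leq_trans (le); apply: compression_sum sC sD => //.
    by apply: IH; rewrite (cardsD1 i I) iI in ltI.
  have /= lePot := minP _ PCD.
  apply/andP; split.
    have [//|nc] := boolP (compressed (I :\ i) X1).
    by have := leq_trans (leq_add (ltC nc) pD) lePot; rewrite addSn ltnn.
  have [//|nc] := boolP (compressed (I :\ i) Y1).
  by have := leq_trans (leq_add pC (ltD nc)) lePot; rewrite addnS ltnn.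
have [cX|ncX] := boolP (compressed I X1); last first.
  have [i iI|i topi ci] := almost_compressed_card e1 X1r _ ncX.
    by case/andP: (sub_compressed i iI).
  by apply: (sum_dominated_half topi e1 e2); rewrite // ?cX1 ?cY1 // -cX1.
have [cY|ncY] := boolP (compressed I Y1); last first.
  have [i iI|i topi ci] := almost_compressed_card e2 Y1r _ ncY.
    by case/andP: (sub_compressed i iI).
  rewrite msumC (msumC X1).
  by apply: (sum_dominated_half topi e2 e1); rewrite // ?cX1 ?cY1 // -cY1.
rewrite (compressed_uniq X1r Xr' cX cX') ?cX1 //.
by rewrite (compressed_uniq Y1r Yr' cY cY') ?cY1.
Qed.
End Sums.

(** * Sets fixed by the compressions that keep the unit vectors *)

Section Structure.
Variable n : nat.
Implicit Types (x y z d r u v : 'rV['F_2]_n) (i j k : 'I_n) (I J : {set 'I_n}).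
Implicit Types (A B C D X Y : {set 'rV['F_2]_n}).

Lemma proj0 I : proj I (0 : 'rV['F_2]_n) = 0.
Proof. by apply: bit_inj => i; rewrite bit_proj bit0 andbF. Qed.

Lemma fiber_eqP I x y : reflect (forall i, i \notin I -> bit x i = bit y i)
  (x \in fiber I (proj I y)).
Proof. by rewrite inE; apply: proj_eqP. Qed.

Lemma fiber0P I x : reflect (forall i, bit x i -> i \in I) (x \in fiber I 0).
Proof.
rewrite -(proj0 I); apply: (iffP (fiber_eqP _ _ _)) => h i.
  by move=> xi; apply: contraLR xi => /h ->; rewrite bit0.
by move=> iI; rewrite bit0; apply: contraNF iI; apply: h.
Qed.

Lemma compressedS I J A : I \subset J -> compressed J A -> compressed I A.
Proof.
move=> IJ /compressedP cA; apply/compressedP => x y xA /eqP/proj_eqP e.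
apply: cA => //; apply/eqP/proj_eqP => i iJ; apply: e.
by apply: contraNN iJ; apply: (subsetP IJ).
Qed.

Lemma compressed_min I D r x : compressed I D -> proj I r = r -> x \in D ->
  proj I x = r -> r \in D.
Proof.
move=> cD rr xD e; have [<-//|nxr] := eqVneq x r.
case/orP: (blt_total nxr) => lt; last first.
  by apply: (compressedP _ _ cD x) => //; rewrite e.
have [i /leadP[xri _] ri] := bltP _ _ lt.
have iI : i \notin I by apply: contraTN ri => iI; rewrite -rr bit_proj iI.
have : proj I x == proj I r by rewrite e rr.
by move/proj_eqP => /(_ i iI) exr; move: xri; rewrite bitD exr addbb.
Qed.

(** If the unit vector of i is missing, all elements of the initial segment
    D :&: <I> precede it, so their bit i vanishes and they fit in half of
    <I>. *)
Lemma compressed_unit I D i : compressed I D -> i \in I ->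
  (2 ^ #|I| < (#|D :&: fiber I 0|).*2)%N -> unit_vec i \in D.
Proof.
move=> cD iI; apply: contraLR => eD; rewrite -leqNgt.
rewrite -(card_fiber (proj0 I)) (card_fiber_half iI (proj0 I)) leq_double.
apply: subset_leq_card; apply/subsetP => x; rewrite in_setI => /andP[xD xI].
rewrite fiber_half ?proj0 // xI /=; apply/negP => xi.
have nxe : unit_vec i != x by apply: contraNneq eD => ->.
case/orP: (blt_total nxe) => lt.
  rewrite (compressedP _ _ cD x) // in eD.
  by rewrite proj_unit // (proj_fiber xI).
have [l /leadP[xl _]] := bltP _ _ lt; rewrite bit_unit => /eqP li.
by move: xl; rewrite li bitD bit_unit eqxx xi.
Qed.

(** Compression along I may lose a unit vector, and with it the affine span,
    when A fills at most half of <I>; compressedness is only demanded for the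
    other I. *)
Definition stable A :=
  forall I, (2 ^ #|I| < (#|A :&: fiber I 0|).*2)%N -> compressed I A.

Lemma stabilization A : 0 \in A -> (forall i, unit_vec i \in A) ->
  exists A', [/\ #|A'| = #|A|, (#|msum A' A'| <= #|msum A A|)%N,
    0 \in A', forall i, unit_vec i \in A' & stable A'].
Proof.
move=> A0 Ae.
pose P C := [&& #|C| == #|A|, (#|msum C C| <= #|msum A A|)%N, 0 \in C &
  [forall i, unit_vec i \in C]].
have PA : P A by rewrite /P eqxx leqnn A0; apply/forallP.
case: (@arg_minnP _ A P (@potential n) PA) => C /and4P[/eqP cC leC C0 /forallP Ce] minC.
exists C; split=> // I bigI.
have [//|ncC] := boolP (compressed I C).
have [D [sD cD _ /(_ ncC) ltD]] := compression_ex I C.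
have bigD : (2 ^ #|I| < (#|D :&: fiber I 0|).*2)%N by rewrite -(same_fibersP _ _ _ sD).
have inD r : r \in C -> proj I r = r -> r \in D.
  move=> rC rr.
  have /card_gt0P[x] : (0 < #|D :&: fiber I r|)%N.
    rewrite -(same_fibersP _ _ _ sD); apply/card_gt0P; exists r.
    by rewrite !inE rC rr eqxx.
  by rewrite inE => /andP[xD /proj_fiber]; apply: compressed_min.
have /minC : P D.
  apply/and4P; split.
  - by rewrite -(same_fibers_card sD) cC.
  - apply: leq_trans (leC); apply: compression_sum (sD) (sD) => //.
    exact: sum_dominatedT.
  - by apply: inD; rewrite // proj0.
  - apply/forallP => i; have [iI|iI] := boolP (i \in I).
      exact: compressed_unit bigD.
    by apply: inD; rewrite // proj_unit_out.
by rewrite leqNgt ltD.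
Qed.

(** A full subspace <J> together with one more unit vector is already more than
    half of the subspace spanned by i and J. *)
Lemma stable_ext A J i : stable A -> unit_vec i \in A -> i \notin J ->
  fiber J 0 \subset A -> compressed (i |: J) A.
Proof.
move=> stA eA iJ JA; apply: stA; rewrite cardsU1 iJ expnS mul2n ltn_double.
rewrite -(card_fiber (proj0 J)); apply: proper_card; apply/properP; split.
  rewrite subsetI JA; apply/subsetP => x /fiber0P xJ; apply/fiber0P => k /xJ kJ.
  by rewrite inE kJ orbT.
exists (unit_vec i).
  rewrite in_setI eA; apply/fiber0P => k; rewrite bit_unit => /eqP ->.
  by rewrite !inE eqxx.
by apply: contra iJ => /fiber0P; apply; rewrite bit_unit.
Qed.

Lemma fiber_set0 : fiber set0 0 = [set 0 : 'rV['F_2]_n].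
Proof.
apply/setP => x; rewrite in_set1; apply/fiber0P/eqP => [h|-> i]; last by rewrite bit0.
by apply: bit_inj => i; rewrite bit0; apply/negbTE/negP => /h; rewrite inE.
Qed.

Lemma fiber_set1_sub A i : 0 \in A -> unit_vec i \in A -> fiber [set i] 0 \subset A.
Proof.
move=> A0 Ae; apply/subsetP => x /fiber0P xi.
have [b|b] := boolP (bit x i).
  suff -> : x = unit_vec i by [].
  apply: bit_inj => j; rewrite bit_unit; have [->|nji] := eqVneq j i => //.
  by apply: contraNF nji => /xi; rewrite inE.
suff -> : x = 0 by [].
apply: bit_inj => j; rewrite bit0; apply: contraNF b => xj.
by have := xi j xj; rewrite inE => /eqP <-.
Qed.

Lemma fiber_disj I A r1 r2 : r1 != r2 -> (A :&: fiber I r1) :&: (A :&: fiber I r2) = set0.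
Proof.
move=> ne; apply/setP => x; rewrite !inE; apply/negP.
case/andP=> /andP[_ /eqP e1] /andP[_ /eqP e2].
by rewrite -e1 -e2 eqxx in ne.
Qed.

Definition below m : {set 'I_n} := [set i : 'I_n | (i < m)%N].

(** The last clause expresses the maximality of m: the subspace spanned by the
    first m + 1 coordinates is the union of the one spanned by the first m and
    of its translate by the next unit vector. *)
Lemma max_initial_subspace A : 0 \in A -> exists m,
  [/\ (m <= n)%N, fiber (below m) 0 \subset A & forall i, val i = m ->
      ~ (forall g, g \in fiber (below m) 0 -> unit_vec i + g \in A)].
Proof.
move=> A0.
pose full m := (m <= n)%N && (fiber (below m) 0 \subset A).
have exf : exists m, full m.
  exists 0%N; rewrite /full leq0n /=; apply/subsetP => x /fiber0P x0.
  suff -> : x = 0 by [].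
  by apply: bit_inj => i; rewrite bit0; apply/negbTE/negP => /x0; rewrite inE.
have ubf m : full m -> (m <= n)%N by case/andP.
have [m /andP[mn mA] maxm] := ex_maxnP exf ubf.
exists m; split=> // i im allA; suff /maxm : full m.+1 by rewrite ltnn.
rewrite /full -im ltn_ord /=; apply/subsetP => x /fiber0P xm.
have low (y : 'rV['F_2]_n) : (forall j, bit y j -> bit x j && (j != i)) ->
    y \in fiber (below m) 0.
  move=> h; apply/fiber0P => j /h /andP[/xm]; rewrite !inE ltnS leq_eqVlt im.
  by case: eqP => //= e _ /eqP[]; apply/val_inj; rewrite im.
have [xi|xi] := boolP (bit x i).
  rewrite -[x](addvKl (unit_vec i)); apply/allA/low => j.
  rewrite bitD bit_unit; case: eqP => [->|_] /=; first by rewrite xi.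
  by rewrite andbT.
apply/(subsetP mA)/low => j xj; rewrite xj /=.
by apply: contraNneq xi => <-.
Qed.

(** From here on G denotes the subspace spanned by the coordinates below m. *)
Section Stable.
Variable A : {set 'rV['F_2]_n}.
Hypothesis A0 : 0 \in A.
Hypothesis Ae : forall i, unit_vec i \in A.
Hypothesis stA : stable A.

Lemma stable_down x y : x \in A -> (forall i, bit y i -> bit x i) -> y \in A.
Proof.
move: {2}#|[set i | bit x i && ~~ bit y i]| (leqnn #|[set i | bit x i && ~~ bit y i]|) => c.
elim: c x => [|c IH] x le xA yx.
  suff -> : y = x by [].
  apply: bit_inj => i; move: le; rewrite leqn0 cards_eq0 => /eqP/setP/(_ i).
  by rewrite !inE; case yi: (bit y i) => //=; [rewrite yx | rewrite andbT].
have [e0|/set0Pn[i]] := eqVneq [set i | bit x i && ~~ bit y i] set0.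
  by apply: (IH x); rewrite // e0 cards0.
rewrite inE => /andP[xi yi].
apply: (IH (x + unit_vec i)).
- rewrite -ltnS; apply: leq_trans le; apply: proper_card; apply/properP; split.
    apply/subsetP => k; rewrite !inE bitD bit_unit.
    by case: eqP => [->|]; rewrite ?xi ?addbF //.
  by exists i; rewrite !inE ?bitD ?bit_unit ?eqxx xi ?yi.
- have c1 : compressed (i |: set0) A.
    by apply: stable_ext; rewrite ?inE // fiber_set0 sub1set.
  apply: (compressedP _ _ c1 x) => //.
    by rewrite projD proj_unit ?addr0 // !inE eqxx.
  by rewrite (blt_add _ (lead_unit i)).
- move=> j yj; rewrite bitD bit_unit (yx _ yj); case: eqP => // ji.
  by rewrite -ji yj in yi.
Qed.

Lemma stable_shift i j x : (i < j)%N -> x \in A -> bit x j -> ~~ bit x i ->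
  x + (unit_vec i + unit_vec j) \in A.
Proof.
move=> ij xA xj xi.
have nij : j \notin [set i] by rewrite inE; apply: contraTneq ij => ->; rewrite ltnn.
have c2 : compressed (j |: [set i]) A.
  by apply: stable_ext => //; apply: fiber_set1_sub.
apply: (compressedP _ _ c2 x) => //.
  by rewrite !projD !proj_unit ?addr0 // !inE eqxx ?orbT.
by rewrite (blt_add _ (lead_unit2 ij)).
Qed.

Variable m : nat.
Local Notation M := (below m).
Hypothesis MA : fiber M 0 \subset A.
Hypothesis Mmax :
  forall i, val i = m -> ~ (forall g, g \in fiber M 0 -> unit_vec i + g \in A).

Lemma outM i : (i \notin M) = (m <= i)%N.
Proof. by rewrite inE -leqNgt. Qed.

(** If A contained e_i + G, shifting the bit i down to position m would show that
    it contains e_m + G. *)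
Lemma not_full i : (m <= i)%N -> ~ (forall g, g \in fiber M 0 -> unit_vec i + g \in A).
Proof.
move=> mi h.
have [eq_mi|lt_mi] : (i = m :> nat \/ m < i)%N by lia.
  exact: Mmax h.
pose k := Ordinal (ltn_trans lt_mi (ltn_ord i)).
apply: (@Mmax k) => // g gM.
have gout j : (m <= j)%N -> bit g j = false.
  by move=> mj; apply/negbTE/negP => /(fiber0P _ _ gM); rewrite inE ltnNge mj.
have kni : k != i by apply: contraTneq (lt_mi) => <-; rewrite /= ltnn.
have -> : unit_vec k + g = unit_vec i + g + (unit_vec k + unit_vec i).
  by rewrite addrCA (addrAC (unit_vec i)) addvv add0r.
apply: stable_shift => //; first exact: h.
  by rewrite bitD bit_unit eqxx gout.
by rewrite bitD bit_unit gout ?leqnn // addbF.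
Qed.

(** Clearing bits gives e_i + e_j in A. Along the coordinates of M and j, this
    element lies above the whole of e_i + G, so that A contains this coset,
    against [not_full]. *)
Lemma one_outside x i j : x \in A -> (m <= i)%N -> (i < j)%N -> bit x i ->
  bit x j -> False.
Proof.
move=> xA mi ij xi xj.
have eA : unit_vec i + unit_vec j \in A.
  apply: stable_down xA _ => k; rewrite bitD !bit_unit.
  by case: eqP => [->|_] //; case: eqP => [->|].
apply: (not_full mi) => g gM.
have cj : compressed (j |: M) A.
  by apply: stable_ext => //; rewrite outM; lia.
apply: (compressedP _ _ cj _ _ eA).
  have g0 : proj (j |: M) g = 0.
    apply: proj_fiber; apply/fiber0P => k /(fiber0P _ _ gM) kM.
    by rewrite in_setU kM orbT.
  by rewrite !projD g0 (@proj_unit _ _ j) // !inE eqxx.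
have -> : unit_vec i + g = unit_vec i + unit_vec j + (unit_vec j + g).
  by rewrite -addrA addvKl.
have gk k : (m <= k)%N -> bit g k = false.
  by move=> mk; apply/negbTE/negP => /(fiber0P _ _ gM); rewrite inE ltnNge mk.
rewrite (@blt_add _ j).
  by rewrite bitD !bit_unit eqxx; case: eqP => // e; rewrite e ltnn in ij.
have mj : (m <= j)%N by apply: leq_trans mi (ltnW ij).
apply/leadP; split=> [|k jk]; rewrite bitD bit_unit.
  by rewrite eqxx gk.
rewrite gk ?addbF; last exact: leq_trans mj (ltnW jk).
by apply/eqP => e; rewrite e ltnn in jk.
Qed.

Definition part i := A :&: fiber M (unit_vec i).

Lemma proj_unitM i : (m <= i)%N -> proj M (unit_vec i) = unit_vec i.
Proof. by rewrite -outM; apply: proj_unit_out. Qed.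

Lemma cardM : (m <= n)%N -> #|M| = m.
Proof.
move=> mn; rewrite -sum1dep_card (big_ord_narrow mn (F := fun=> 1%N)).
by rewrite sum1_card card_ord.
Qed.

Hypothesis mn : (m <= n)%N.

Lemma card_part_gt0 i : (m <= i)%N -> (0 < #|part i|)%N.
Proof.
move=> mi; apply/card_gt0P; exists (unit_vec i).
by rewrite !inE Ae proj_unitM ?eqxx.
Qed.

Lemma card_part_le i : (m <= i)%N -> (#|part i| <= 2 ^ m)%N.
Proof.
move=> mi; rewrite -(cardM mn) -(card_fiber (proj_unitM mi)).
by apply: subset_leq_card; apply: subsetIr.
Qed.

(** Otherwise A fills more than half of the subspace spanned by i, j and M, so it
    is an initial segment there and contains all its vectors without bit j, in
    particular e_i + G, against [not_full]. *)
Lemma card_pair_le i j : (m <= i)%N -> (i < j)%N ->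
  (#|part i| + #|part j| <= 2 ^ m)%N.
Proof.
move=> mi ij; rewrite leqNgt; apply/negP => big.
have mj : (m <= j)%N by lia.
have nij : i != j by apply: contraTneq ij => ->; rewrite ltnn.
pose I := j |: (i |: M).
have cI : #|I| = m.+2.
  by rewrite !cardsU1 (cardM mn) !inE negb_or -!leqNgt mi mj eq_sym nij.
have MI : fiber M 0 \subset fiber I 0.
  by apply/subsetP => x /fiber0P h; apply/fiber0P => k /h kM; rewrite !inE in kM *; rewrite kM !orbT.
have partI k : k \in I -> part k \subset fiber I 0.
  move=> kI; apply/subsetP => x; rewrite !inE => /andP[_ /eqP e].
  rewrite -(proj0 I); apply/proj_eqP => l lI; rewrite bit0.
  have lM : l \notin M by apply: contraNN lI => lM; rewrite !inE in lM *; rewrite lM !orbT.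
  have := bit_proj M x l; rewrite lM e bit_unit /= => <-.
  by apply: contraNF lI => /eqP ->.
have bigI : (2 ^ m.+1 < #|A :&: fiber I 0|)%N.
  have sub : (A :&: fiber M 0) :|: (part i :|: part j) \subset A :&: fiber I 0.
    have iI : i \in I by rewrite !in_setU !in_set1 eqxx orbT.
    have jI : j \in I by rewrite in_setU in_set1 eqxx.
    rewrite !subUset; apply/and3P; split; rewrite subsetI subsetIl /=.
    - by apply: subset_trans (subsetIr _ _) MI.
    - exact: partI.
    - exact: partI.
  apply: leq_trans (subset_leq_card sub).
  rewrite cardsU setIUr !fiber_disj ?unit_vec_neq0 // setU0 cards0 subn0.
  rewrite cardsU fiber_disj ?(inj_eq (@unit_vec_inj n)) // cards0 subn0.
  rewrite (setIidPr MA) (card_fiber (proj0 M)) (cardM mn).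
  by rewrite expnS mul2n -addnn ltn_add2l.
have cI0 : compressed I A.
  by apply: stA; rewrite cI expnS mul2n ltn_double.
have topj : topmost j I.
  apply/topmostP; split; first by rewrite !inE eqxx.
  by move=> k; rewrite !inE => /orP[/eqP-> //|/orP[/eqP->|km]]; lia.
have jI : j \in I by case/topmostP: topj.
have half : fiber (I :\ j) 0 \subset A :&: fiber I 0.
  apply: (@compressed_chain _ I 0).
  - by apply: fiber_half_sub; rewrite ?proj0.
  - exact: subsetIr.
  - by apply: half_compressed; rewrite ?proj0.
  - exact: compressed_fiber.
  - have := card_fiber_half jI (proj0 I); rewrite (card_fiber (proj0 I)) cI expnS mul2n.
    by move/double_inj => <-; apply: ltnW.
apply: (not_full mi) => g /fiber0P gM.
have /(subsetP half) : unit_vec i + g \in fiber (I :\ j) 0.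
  apply/fiber0P => k; rewrite bitD bit_unit !inE.
  case: eqP => [-> _|_] /=; first by rewrite nij orbT.
  move=> /gM; rewrite inE => km; rewrite km !orbT andbT.
  by apply/eqP => e; rewrite e ltnNge mj in km.
by rewrite inE => /andP[].
Qed.
Lemma card_stable : #|A| = (2 ^ m + \sum_(i : 'I_n | (m <= i)%N) #|part i|)%N.
Proof.
pose N := [set i : 'I_n | (m <= i)%N].
have injU : {in N &, injective (@unit_vec n)}.
  by move=> k l _ _; apply: unit_vec_inj.
have F0 r : r \notin 0 |: [set unit_vec i | i in N] -> #|A :&: fiber M r| = 0%N.
  move=> rS; apply/eqP; rewrite cards_eq0; apply: contraNT rS => /set0Pn[x].
  rewrite !inE => /andP[xA /eqP <-].
  have [//|/lead_ex[j /leadP[]]] := eqVneq (proj M x) 0.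
  rewrite bit_proj => /andP[jM xj] _; apply/imsetP; exists j; first by rewrite inE -outM.
  apply: bit_inj => k; rewrite bit_proj bit_unit.
  have [->|nkj] := eqVneq k j; first by rewrite jM xj.
  apply: contraNF nkj => /andP[kM xk]; apply/eqP/val_inj.
  rewrite !outM in jM kM; case: (ltngtP k j) => // lt.
    by case: (one_outside xA kM lt).
  by case: (one_outside xA jM lt).
rewrite (card_fibers M) (bigID (mem (0 |: [set unit_vec i | i in N]))) /=.
rewrite [X in (_ + X)%N]big1 // addn0 big_setU1 /=; last first.
  apply/negP => /imsetP[i _ e]; by have := unit_vec_neq0 i; rewrite -e eqxx.
rewrite big_imset //= (setIidPr MA) (card_fiber (proj0 M)) (cardM mn).
by congr (_ + _)%N; apply: eq_bigl => i; rewrite inE.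
Qed.

(** The cosets G, e_i + G and e_i + e_j + G are pairwise distinct, and the first
    two kinds are contained in A + A because A contains G and e_i. *)
Lemma card_sum_stable :
  ((n - m).+1 * 2 ^ m +
   \sum_(p : 'I_n * 'I_n | (m <= p.1 < p.2)%N) #|msum (part p.1) (part p.2)|
   <= #|msum A A|)%N.
Proof.
pose N := [set i : 'I_n | (m <= i)%N].
pose P := [set p : 'I_n * 'I_n | (m <= p.1 < p.2)%N].
pose e2 (p : 'I_n * 'I_n) := unit_vec p.1 + unit_vec p.2.
have injU : {in N &, injective (@unit_vec n)}.
  by move=> k l _ _; apply: unit_vec_inj.
have lead2 p : p \in P -> lead p.2 (e2 p).
  by rewrite inE => /andP[_]; apply: lead_unit2.
have injP : {in P &, injective e2}.
  move=> [i j] [k l] pP qP e; have := lead2 _ pP; rewrite e.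
  move/lead_uniq => /(_ _ (lead2 _ qP)) /= jl; move: e; rewrite jl /e2 /=.
  by move/addIr => /injU ->; rewrite ?inE //; [case/setIdP: pP|case/setIdP: qP].
have disj0 : 0 \notin [set unit_vec i | i in N] :|: [set e2 p | p in P].
  rewrite inE; apply/negP => /orP[] /imsetP[i iN e].
    by have := unit_vec_neq0 i; rewrite -e eqxx.
  by have /leadP[] := lead2 _ iN; rewrite -e bit0.
have disj1 : [disjoint [set unit_vec i | i in N] & [set e2 p | p in P]].
  apply/pred0P => r /=; apply/negP => /andP[/imsetP[i _ ->] /imsetP[p pP e]].
  have ip : i = p.2 by apply: lead_uniq (lead_unit i) _; rewrite e lead2.
  move: e; rewrite ip /e2 -{1}[unit_vec p.2]add0r => /addIr e.
  by have := unit_vec_neq0 p.1; rewrite -e eqxx.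
have AM r : r \in A -> (2 ^ m <= #|msum A A :&: fiber M (proj M r)|)%N.
  move=> rA; rewrite -{1}(cardM mn) -(card_fiber (projK M r)); apply: subset_leq_card.
  rewrite subsetI subxx andbT; apply/subsetP => x xr.
  rewrite -[x](addvK _ r) addrC; apply: mem_msum => //.
  by apply: (subsetP MA); rewrite inE projD (proj_fiber xr) addvv.
rewrite (card_fibers M (msum A A)).
pose S := 0 |: ([set unit_vec i | i in N] :|: [set e2 p | p in P]).
rewrite [X in (_ <= X)%N](bigID (mem S)) /=; apply: leq_trans (leq_addr _ _).
have -> : (\sum_(r in S) #|msum A A :&: fiber M r| = #|msum A A :&: fiber M 0| +
    \sum_(i in N) #|msum A A :&: fiber M (unit_vec i)| +
    \sum_(p in P) #|msum A A :&: fiber M (e2 p)|)%N.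
  rewrite big_setU1 // -addnA; congr (_ + _)%N.
  rewrite (eq_bigl _ _ (fun r => in_setU r _ _)) bigU //=.
  by congr (_ + _)%N; rewrite big_imset.
apply: leq_add; last first.
  rewrite [X in (X <= _)%N](eq_bigl (fun p => p \in P)) => [|p]; last by rewrite in_set.
  apply: leq_sum => -[i j] _.
  apply: subset_leq_card; rewrite subsetI msumS ?subsetIl //=.
  by apply: msum_fiber; apply: subsetIr.
rewrite mulSn leq_add //.
  by rewrite -(proj0 M); apply: AM.
have -> : (n - m)%N = #|N|.
  have -> : N = ~: M by apply/setP => i; rewrite !inE -leqNgt.
  by rewrite cardsCs setCK (cardM mn) card_ord.
rewrite -sum_nat_const; apply: leq_sum => i; rewrite inE => mi.
by rewrite -[X in fiber M X](proj_unitM mi); apply: AM.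
Qed.

Lemma card_sum_part i j : (m <= j)%N -> (#|part i| <= #|msum (part i) (part j)|)%N.
Proof. by move=> /card_part_gt0/card_gt0P[x]; apply: card_msuml. Qed.

Lemma part_compressed i : (m <= i)%N -> compressed M (part i).
Proof.
move=> mi; apply: compressed_fiber; apply: (@compressedS _ (i |: M)).
  exact: subsetUr.
by apply: stable_ext; rewrite ?outM.
Qed.

(** If both sizes are at most |G|/2, both initial segments lie in the half of
    their coset where the topmost bit of M vanishes. Being larger than a quarter
    of G, they fill the corresponding half of e_i + e_j + G by the pigeonhole
    principle. If one size exceeds |G|/2, that part alone suffices. *)
Lemma card_sum_part_half i j : (m <= i)%N -> (m <= j)%N ->
  (2 ^ m < 4 * #|part i|)%N -> (2 ^ m < 4 * #|part j|)%N ->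
  (2 ^ m <= 2 * #|msum (part i) (part j)|)%N.
Proof.
move=> mi mj bi bj.
have pij := card_sum_part i mj.
have pji := card_sum_part j mi; rewrite msumC in pji.
have [ai|ai] := leqP (2 ^ m) (2 * #|part i|); first by lia.
have [aj|aj] := leqP (2 ^ m) (2 * #|part j|); first by lia.
have ui := proj_unitM mi; have uj := proj_unitM mj.
have [k0 k0M] : exists k, k \in M.
  have m0 : (0 < m)%N by have := card_part_gt0 mi; case: (m) ai => // ; lia.
  have n0 : (0 < n)%N by lia.
  by exists (Ordinal n0); rewrite inE.
have [k topk] := topmost_ex k0M; have kM : k \in M by case/topmostP: topk.
have ch r : proj M r = r -> (2 ^ m = #|fiber (M :\ k) r|.*2)%N.
  by move=> rr; rewrite -(card_fiber_half kM rr) (card_fiber rr) (cardM mn).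
have hs (l : 'I_n) : (m <= l)%N -> (2 * #|part l| < 2 ^ m)%N ->
    part l \subset fiber (M :\ k) (unit_vec l).
  move=> ml al; have ul := proj_unitM ml.
  apply: (@compressed_chain _ M (unit_vec l)).
  - exact: subsetIr.
  - exact: fiber_half_sub.
  - exact: part_compressed.
  - exact: half_compressed.
  - by have := ch _ ul; lia.
have proj' r : proj M r = r -> proj (M :\ k) r = r.
  move=> rr; apply: bit_inj => l; rewrite -{}rr !bit_proj in_setD1.
  by case: (l \in M); rewrite ?andbF.
have cMk : (2 ^ #|M :\ k|)%N = #|fiber (M :\ k) (unit_vec i)|.
  by rewrite (card_fiber (proj' _ ui)).
have /subset_leq_card : fiber (M :\ k) (unit_vec i + unit_vec j)
    \subset msum (part i) (part j).
  apply: pigeonhole_fiber; rewrite ?proj' ?hs // cMk.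
  by have := ch _ ui; lia.
have uij : proj M (unit_vec i + unit_vec j) = unit_vec i + unit_vec j.
  by rewrite projD ui uj.
by have := ch _ uij; lia.
Qed.
End Stable.
End Structure.

(** * The inequality between densities *)

Section OffDiagonal.
Variables (R : realFieldType) (T : finType).
Implicit Types (N : {set T}) (f g : T -> T -> R) (a : T -> R).

Lemma sum_const N (c : R) : \sum_(i in N) c = #|N|%:R * c.
Proof. by rewrite sumr_const mulr_natl. Qed.

(** Sum over the pairs of distinct indices, written so that the double sum has
    no side condition. *)
Definition offdiag N f := \sum_(i in N) \sum_(j in N) f i j - \sum_(i in N) f i i.

Lemma ler_offdiag N f g :
  {in N &, forall i j, i != j -> f i j <= g i j} -> offdiag N f <= offdiag N g.
Proof.
move=> le; rewrite /offdiag -!sumrB; apply: ler_sum => i iN.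
rewrite !(bigD1 i iN) /= ![f i i + _]addrC ![g i i + _]addrC !addrK.
by apply: ler_sum => j /andP[jN ji]; apply: le; rewrite // eq_sym.
Qed.

Lemma offdiag_add N a :
  offdiag N (fun i j => a i + a j) = 2 * (#|N|%:R - 1) * \sum_(i in N) a i.
Proof.
rewrite /offdiag big_split /=.
under eq_bigr do rewrite big_split /= sum_const.
by rewrite big_split /= sum_const -mulr_sumr; ring.
Qed.

Lemma offdiag_const N (c : R) : offdiag N (fun _ _ => c) = #|N|%:R * (#|N|%:R - 1) * c.
Proof.
rewrite /offdiag; under eq_bigr do rewrite sum_const.
by rewrite !sum_const; ring.
Qed.

(** Sum the hypothesis over all pairs. *)
Lemma pairwise_sum_le N a : {in N &, forall i j, i != j -> a i + a j <= 1} ->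
  (1 < #|N|)%N -> 2 * \sum_(i in N) a i <= #|N|%:R.
Proof.
move=> ha N1.
have := ler_offdiag ha; rewrite offdiag_add (offdiag_const N 1) mulr1.
have N0 : 0 < #|N|%:R - 1 :> R by rewrite subr_gt0 ltr1n.
by rewrite mulrAC ler_pM2r.
Qed.

Lemma pairwise_sum_le1 N a : {in N, forall i, a i <= 1} ->
  {in N &, forall i j, i != j -> a i + a j <= 1} ->
  2 * \sum_(i in N) a i <= #|N|%:R + 1.
Proof.
move=> a1 ha; have [N1|] := ltnP 1 #|N|.
  by apply: le_trans (pairwise_sum_le ha N1) _; rewrite lerDl.
rewrite leq_eqVlt ltnS leqn0 => /orP[/cards1P[i Ni]|].
  rewrite Ni big_set1 cards1; have := a1 i; rewrite Ni inE eqxx => /(_ isT).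
  by lra.
by rewrite cards_eq0 => /eqP ->; rewrite big_set0 cards0; lra.
Qed.
End OffDiagonal.

Lemma quadratic_le_pow2 u : (1 < u)%N -> (u * (u + 2) <= 3 * 2 ^ u)%N.
Proof.
elim: u => // u IH; rewrite ltnS leq_eqVlt => /orP[/eqP <- //|u1].
by have := IH u1; rewrite expnS; nia.
Qed.

Lemma linear_le_pow2 u : (1 < u)%N -> (u + 2 <= 2 ^ u)%N.
Proof.
elim: u => // u IH; rewrite ltnS leq_eqVlt => /orP[/eqP <- //|u1].
by have := IH u1; rewrite expnS; lia.
Qed.

(** Here q and p are the numbers of weights above and at most 1/4, and x and y
    are their sums. If there are many small weights, the lower bound on x and the
    upper bound on y contradict the last hypothesis. Otherwise x enters it with a
    positive coefficient; as x <= (q + 1)/2, fewer than four weights are small,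
    and x has to be within 1 of this maximum. *)
Lemma large_small_bound (R : realFieldType) (q p x y : R) :
  0 <= q -> 0 <= p -> 5 <= q + p -> q / 4 <= x -> 2 * x <= q + 1 ->
  0 <= y -> y <= p / 4 ->
  q + p + q * (q - 1) / 2 <= (q + 2 - p) * x + (q + 3) * y ->
  q + p - 4 <= 2 * (1 + x + y).
Proof.
move=> q0 p0 qp x_lo x_hi y_lo y_hi key.
have y_hi' : (q + 3) * y <= (q + 3) * (p / 4) by apply: ler_wpM2l; lra.
have [pq|pq] := lerP (q + 2) p.
  (* Few large weights: the lower bound on x makes the hypothesis fail. *)
  have : (q + 2 - p) * x <= (q + 2 - p) * (q / 4) by apply: ler_wnM2l; lra.
  nra.
have D0 : 0 < q + 2 - p by lra.
have x_hi' : (q + 2 - p) * x <= (q + 2 - p) * ((q + 1) / 2).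
  by apply: ler_wpM2l; lra.
have p4 : p < 4.
  have h : p * (q + 3) < 4 * (q + 3) by nra.
  by rewrite ltr_pM2r in h; lra.
have x_lo' : (q + 1) / 2 - 1 <= x.
  rewrite leNgt; apply/negP => small.
  have : (q + 2 - p) * x <= (q + 2 - p) * ((q + 1) / 2 - 1).
    by apply: ler_wpM2l; lra.
  have : 0 <= p * (q - 1) by apply: mulr_ge0; lra.
  nra.
lra.
Qed.

(** The numbers [a i] stand for the densities |part i| / |G|, and [w i j] for the
    densities of the sums of two parts. *)
Section Weights.
Variables (R : realFieldType) (T : finType) (N : {set T}).
Variables (a : T -> R) (w : T -> T -> R).
Hypothesis a_ge0 : {in N, forall i, 0 <= a i}.
Hypothesis a_le1 : {in N, forall i, a i <= 1}.
Hypothesis a_pair : {in N &, forall i j, i != j -> a i + a j <= 1}.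
Hypothesis w_l : {in N &, forall i j, i != j -> a i <= w i j}.
Hypothesis w_r : {in N &, forall i j, i != j -> a j <= w i j}.
Hypothesis w_half : {in N &, forall i j, i != j ->
  1 / 4 < a i -> 1 / 4 < a j -> 1 / 2 <= w i j}.

Local Notation t := (#|N|%:R : R).
Local Notation sigma := (\sum_(i in N) a i).
Local Notation Q := [set i in N | 1 / 4 < a i].
Local Notation P := (N :\: Q).
Local Notation q := (#|Q|%:R : R).
Local Notation p := (#|P|%:R : R).
Local Notation sigmaQ := (\sum_(i in Q) a i).
Local Notation sigmaP := (\sum_(i in P) a i).

Lemma offdiag_ge_avg : (t - 1) * sigma <= offdiag N w.
Proof.
have := @ler_offdiag _ _ N (fun i j => a i / 2 + a j / 2) w.
rewrite (offdiag_add N (fun i => a i / 2)) -mulr_suml.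
have -> : 2 * (t - 1) * (sigma / 2) = (t - 1) * sigma by field.
apply=> i j iN jN ij.
by have := w_l iN jN ij; have := w_r iN jN ij; lra.
Qed.

Lemma large_sub : Q \subset N. Proof. by apply/subsetP => i; rewrite inE => /andP[]. Qed.

Lemma sum_large_small (f : T -> R) : \sum_(i in N) f i = \sum_(i in Q) f i + \sum_(i in P) f i.
Proof. by rewrite (big_setID Q) (setIidPr large_sub). Qed.

Lemma card_large_small : t = q + p.
Proof. by rewrite -natrD -(cardsID Q N) (setIidPr large_sub). Qed.

(** Two large weights contribute at least 1/2 by [w_half], a large and a small
    one at least the large one, and two small ones at least their average. *)
Lemma offdiag_ge_split :
  q * (q - 1) / 2 + 2 * p * sigmaQ + (p - 1) * sigmaP <= offdiag N w.
Proof.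
pose b i j := if i \in Q then (if j \in Q then 1 / 2 else a i)
              else (if j \in Q then a j else a i / 2 + a j / 2).
have inP i : i \in P -> (i \in Q) = false by rewrite in_setD => /andP[/negbTE].
have rowQ i : i \in Q -> \sum_(j in N) b i j = q / 2 + p * a i.
  move=> iQ; rewrite sum_large_small /b iQ; under eq_bigr => j -> do [].
  rewrite sum_const; under eq_bigr => j /inP -> do [].
  by rewrite sum_const; field.
have rowP i : i \in P -> \sum_(j in N) b i j = sigmaQ + (p * a i + sigmaP) / 2.
  move=> /inP iQ; rewrite sum_large_small /b iQ; under eq_bigr => j -> do [].
  under [X in _ + X]eq_bigr => j /inP -> do [].
  by rewrite big_split /= sum_const -mulr_suml; field.
have diagQ i : i \in Q -> b i i = 1 / 2 by rewrite /b => ->.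
have diagP i : i \in P -> b i i = a i by rewrite /b => /inP ->; field.
have : offdiag N b <= offdiag N w.
  apply: ler_offdiag => i j iN jN ij; have := w_l iN jN ij.
  have := w_r iN jN ij; have := w_half iN jN ij; rewrite /b !inE iN jN /=.
  by case: ltP => ai; case: ltP => aj; move=> h ? ?; try have := h isT isT; lra.
apply: le_trans; rewrite /offdiag !sum_large_small (eq_bigr _ rowQ) (eq_bigr _ rowP).
rewrite (eq_bigr _ diagQ) (eq_bigr _ diagP) !big_split /= !sum_const.
rewrite -!mulr_suml big_split /= !sum_const -!mulr_sumr.
by rewrite le_eqVlt; apply/orP; left; apply/eqP; field.
Qed.

(** By [offdiag_ge_avg] the hypothesis gives
    [t + 3 <= (s + 2 - t) (1 + sigma)]. When s >= t + 2 this implies the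
    conclusion, 2^(s - t) being large compared with s - t. The case s <= t is
    excluded by [sigma <= t/2]. For s = t + 1 it only yields (t + 3)/3 where about
    t/2 is needed, and the weights are split at 1/4; the constant 5 absorbs
    the loss in [large_small_bound]. *)
Lemma weights_bound (s : nat) :
  2 * (1 + t) + offdiag N w <= (s%:R + 1) * (1 + sigma) ->
  (s%:R - 5) * 2 ^+ #|N| <= (1 + sigma) * 2 ^+ s.
Proof.
move=> H.
have s_ge0 : 0 <= sigma by apply: sumr_ge0.
have X0 : 0 < 2 ^+ #|N| :> R by apply: exprn_gt0.
have Y0 : 0 < 2 ^+ s :> R by apply: exprn_gt0.
have [s5|s5] := leqP s 5.
  apply: (@le_trans _ _ 0).
    apply: mulr_le0_ge0; last exact: ltW.
    by rewrite subr_le0 (ler_nat _ _ 5).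
  by apply: mulr_ge0; [apply: addr_ge0 | apply: ltW].
have avg := offdiag_ge_avg.
have [st|st] := leqP #|N|.+2 s.
  pose u := (s - #|N|)%N; have us : (s = #|N| + u)%N by rewrite /u; lia.
  have u2 : (2 <= u)%N by rewrite /u; lia.
  have sE : s%:R = t + u%:R :> R by rewrite us natrD.
  have Hu : t + 3 <= (u%:R + 2) * (1 + sigma) by rewrite sE in H; lra.
  have Hpow : (u%:R + 2) * (t + u%:R) <= (t + 3) * 2 ^+ u.
    rewrite -!natrD -natrX -!natrM ler_nat.
    have := quadratic_le_pow2 u2; have := linear_le_pow2 u2; nia.
  have Z0 : 0 < 2 ^+ u :> R by apply: exprn_gt0.
  have u0 : 0 < u%:R + 2 :> R by have := ler0n R u; lra.
  have Htu : t + u%:R <= (1 + sigma) * 2 ^+ u.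
    rewrite -(ler_pM2l u0); apply: le_trans Hpow _.
    by rewrite mulrA ler_wpM2r // ltW.
  rewrite sE us exprD [X in _ <= _ * X]mulrC mulrA.
  apply: ler_wpM2r; first exact: ltW.
  by apply: le_trans Htu; lra.
have t5 : (5 <= #|N|)%N by lia.
have t5R : 5 <= t by rewrite (ler_nat _ 5).
have pairs := pairwise_sum_le a_pair (leq_trans (isT : (1 < 5)%N) t5).
have sE : s = #|N|.+1.
  apply/eqP; rewrite eqn_leq -ltnS st /= ltnNge -(ler_nat R); apply/negP => les.
  have : (s%:R + 1 - (t + 1)) * (1 + sigma) <= 0 by apply: mulr_le0_ge0; lra.
  lra.
have sER : s%:R = t + 1 by rewrite sE -natr1.
rewrite sE exprS mulrA; apply: ler_wpM2r; first exact: ltW.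
rewrite -sE sER; rewrite sER in H; rewrite card_large_small in t5R H *.
have split := offdiag_ge_split.
have Q_lo : q / 4 <= sigmaQ.
  have -> : q / 4 = q * (1 / 4) by field.
  by rewrite -sum_const; apply: ler_sum => i; rewrite inE => /andP[_ /ltW].
have P_hi : sigmaP <= p / 4.
  have -> : p / 4 = p * (1 / 4) by field.
  rewrite -sum_const; apply: ler_sum => i; rewrite !inE => /andP[+ iN].
  by rewrite iN /= -leNgt.
have Q_hi : 2 * sigmaQ <= q + 1.
  apply: pairwise_sum_le1 => [i|i j] iQ; first by apply/a_le1/(subsetP large_sub).
  by move=> jQ; apply: a_pair; apply: (subsetP large_sub).
have P_lo : 0 <= sigmaP by apply: sumr_ge0 => i; rewrite inE => /andP[_ /a_ge0].
rewrite sum_large_small in H *.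
have : q + p - 4 <= 2 * (1 + sigmaQ + sigmaP).
  by apply: large_small_bound; rewrite ?ler0n //; lra.
lra.
Qed.
End Weights.

Lemma offdiag_ord (R : realFieldType) n (N : {set 'I_n}) (f : 'I_n -> 'I_n -> R) :
  (forall i j, f i j = f j i) ->
  offdiag N f = 2 * \sum_(p : 'I_n * 'I_n |
    [&& p.1 \in N, p.2 \in N & (p.1 < p.2)%N]) f p.1 p.2.
Proof.
move=> fC; pose U := \sum_(i in N) \sum_(j in N | (i < j)%N) f i j.
have -> : \sum_(p : 'I_n * 'I_n |
    [&& p.1 \in N, p.2 \in N & (p.1 < p.2)%N]) f p.1 p.2 = U.
  by rewrite /U pair_big_dep; apply: eq_bigl => -[i j].
have UE : U = \sum_(i in N) \sum_(j in N | (j < i)%N) f i j.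
  rewrite /U (exchange_big_dep (mem N)) /= => [|i j _ /andP[]//].
  apply: eq_bigr => i iN; apply: eq_big => [j|j _]; last exact: fC.
  by rewrite iN.
rewrite mulr2n mulrDl mul1r {2}UE /offdiag -sumrB -big_split /=.
apply: eq_bigr => i iN; rewrite (bigD1 i iN) /= [f i i + _]addrC addrK.
rewrite (bigID (fun j : 'I_n => (i < j)%N)) /=; congr (_ + _).
  apply: eq_bigl => j; rewrite -andbA; congr (_ && _).
  by rewrite -val_eqE /=; case: (ltngtP i j).
apply: eq_bigl => j; rewrite -andbA; congr (_ && _).
by rewrite -val_eqE /=; case: (ltngtP i j).
Qed.

(** After stabilization, sizes divided by |G| = 2^m satisfy the hypotheses of
    [weights_bound], and n - m is the number of densities. *)
Theorem basis_spanning_bound n (A : {set 'rV['F_2]_n}) (s : nat) :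
  0 \in A -> (forall i, unit_vec i \in A) ->
  (2 * #|msum A A| <= s.+1 * #|A|)%N -> ((s - 5) * 2 ^ n <= 2 ^ s * #|A|)%N.
Proof.
move=> A0 Ae; have [B [<- leB B0 Be stB]] := stabilization A0 Ae => doubling.
have {leB doubling} : (2 * #|msum B B| <= s.+1 * #|B|)%N.
  by apply: leq_trans doubling; rewrite leq_mul2l.
clear A A0 Ae; move=> doubling.
have [m [mn mB Mmax]] := max_initial_subspace B0.
pose N : {set 'I_n} := [set i : 'I_n | (m <= i)%N].
have cN : #|N| = (n - m)%N.
  have -> : N = ~: below n m by apply/setP => i; rewrite !inE -leqNgt.
  by rewrite cardsCs setCK (cardM mn) card_ord.
pose G : rat := 2 ^+ m; have G0 : 0 < G by apply: exprn_gt0.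
pose a (i : 'I_n) : rat := #|part B m i|%:R / G.
pose w (i j : 'I_n) : rat := #|msum (part B m i) (part B m j)|%:R / G.
have divG (k l : nat) : (k%:R / G <= l%:R / G) = (k <= l)%N.
  by rewrite ler_pM2r ?invr_gt0 // ler_nat.
have GE : G = (2 ^ m)%:R by rewrite natrX.
have a_ge0 : {in N, forall i, 0 <= a i}.
  by move=> i _; apply: divr_ge0; [apply: ler0n | apply: ltW].
have a_le1 : {in N, forall i, a i <= 1}.
  move=> i; rewrite inE => mi; rewrite ler_pdivrMr // mul1r GE ler_nat.
  exact: card_part_le.
have a_pair : {in N &, forall i j, i != j -> a i + a j <= 1}.
  move=> i j; rewrite !inE => mi mj ij.
  rewrite -mulrDl ler_pdivrMr // mul1r GE -natrD ler_nat.
  case: (ltngtP i j) => [lt|lt|/val_inj e]; last by rewrite e eqxx in ij.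
    exact: card_pair_le lt.
  by rewrite addnC; apply: card_pair_le lt.
have w_l : {in N &, forall i j, i != j -> a i <= w i j}.
  move=> i j; rewrite !inE => mi mj _; rewrite divG.
  exact: card_sum_part.
have w_r : {in N &, forall i j, i != j -> a j <= w i j}.
  move=> i j; rewrite !inE => mi mj _; rewrite divG msumC.
  exact: card_sum_part.
have w_half : {in N &, forall i j, i != j ->
    1 / 4 < a i -> 1 / 4 < a j -> 1 / 2 <= w i j}.
  have quarter (i : 'I_n) : (1 / 4 < a i) = (2 ^ m < 4 * #|part B m i|)%N.
    rewrite ltr_pdivlMr // mulrAC ltr_pdivrMr // mul1r GE -natrM ltr_nat.
    by rewrite mulnC.
  move=> i j; rewrite !inE !quarter => mi mj _ bi bj.
  rewrite ler_pdivlMr // mulrAC ler_pdivrMr // mul1r GE -natrM ler_nat mulnC.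
  exact: card_sum_part_half.
have := @weights_bound _ _ N a w a_ge0 a_le1 a_pair w_l w_r w_half s.
have sigmaE : (1 + \sum_(i in N) a i) * G = #|B|%:R.
  rewrite (card_stable B0 Be stB mB Mmax mn) natrD natr_sum mulrDl mul1r GE.
  congr (_ + _); rewrite mulr_suml; apply: eq_big => i; rewrite ?inE //.
  by rewrite -GE divfK // gt_eqF.
rewrite cN => /(_ _) concl.
have {}concl : (s%:R - 5) * 2 ^+ (n - m) <= (1 + \sum_(i in N) a i) * 2 ^+ s.
  apply: concl; rewrite -(ler_pM2r G0) -[X in _ <= X]mulrA sigmaE.
  have sumE : (n - m).+1%:R * G + offdiag N w / 2 * G <= #|msum B B|%:R.
    apply: le_trans (_ : ((n - m).+1 * 2 ^ m +
      \sum_(p : 'I_n * 'I_n | (m <= p.1 < p.2)%N)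
        #|msum (part B m p.1) (part B m p.2)|)%N%:R <= _).
      rewrite natrD natrM -GE lerD2l offdiag_ord => [|i j]; last by rewrite /w msumC.
      rewrite (mulrC 2) mulfK // natr_sum mulr_suml le_eqVlt; apply/orP; left.
      apply/eqP; apply: eq_big => [[i j]|p _].
        by rewrite !inE /=; lia.
      by rewrite divfK // gt_eqF.
    by rewrite ler_nat card_sum_stable.
  have : (2 * #|msum B B|)%:R <= (s.+1 * #|B|)%:R :> rat by rewrite ler_nat.
  rewrite !natrM -!natr1; move: sumE; rewrite -natr1; lra.
have [s5|/ltnW s5] := leqP s 5; first by rewrite (eqP s5) mul0n.
have nE : 2 ^+ n = 2 ^+ (n - m) * G :> rat by rewrite -exprD subnK.
rewrite -(ler_nat rat) !natrM natrB // -sigmaE !natrX nE !mulrA ler_pM2r //.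
by rewrite [X in _ <= X]mulrC.
Qed.

(** * Passing to affine coordinates *)

Lemma unit_vecE n (i : 'I_n) : unit_vec i = delta_mx 0 i.
Proof.
apply: bit_inj => j; rewrite bit_unit /bit mxE eqxx /=.
by case: (j == i).
Qed.

Lemma group_set_image n d (M : 'M['F_2]_(d, n)) :
  group_set [set x *m M | x : 'rV_d].
Proof.
apply/group_setP; split; first by apply/imsetP; exists 0; rewrite ?mul0mx.
move=> _ _ /imsetP[x _ ->] /imsetP[y _ ->].
by apply/imsetP; exists (x + y); rewrite ?mulmxDl.
Qed.

Lemma card_affine_span_le n d (A : {set 'rV['F_2]_n}) (M : 'M['F_2]_(d, n)) a :
  A != set0 -> (forall x, x \in A -> exists u : 'rV_d, x = u *m M + a) ->
  (#|affine_span A| <= 2 ^ d)%N.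
Proof.
move=> A0 cover; pose H := group (group_set_image M).
have coC : is_coset (H :* a)%g.
  by apply/existsP; exists H; apply/rcosetsP; exists a; rewrite ?inE.
have AC : A \subset (H :* a)%g.
  apply/subsetP => x /cover[u ->]; apply/rcosetP; exists (u *m M) => //.
  by apply/imsetP; exists u.
have [_ _ /(_ _ coC AC) /subset_leq_card] := affine_spanP A0.
move/leq_trans; apply; rewrite card_rcoset.
apply: leq_trans (leq_imset_card _ _) _.
by rewrite card_mx card_Fp // mul1n.
Qed.

(** A maximal independent family of rows of B, the translates of A by one of its
    elements, gives affine coordinates on the span of A in which A contains 0
    and the unit vectors. *)
Theorem spanning_bound n (A : {set 'rV['F_2]_n}) (s : nat) : A != set0 ->
  (2 * #|sumset A| <= s.+1 * #|A|)%N ->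
  ((s - 5) * #|affine_span A| <= 2 ^ s * #|A|)%N.
Proof.
move=> An0 doubling; have [a0 a0A] := set0Pn _ An0.
pose B : 'M['F_2]_(#|A|, n) := \matrix_(i < #|A|) (enum_val i + a0).
pose f := maxrankfun B; pose M := rowsub f B.
pose phi u := u *m M + a0.
have phi_inj : injective phi.
  by move=> u v /addIr; apply: row_free_inj; apply: maxrowsub_free.
have cover x : x \in A -> exists u, x = phi u.
  move=> xA; have : ((x + a0)%R <= M)%MS.
    rewrite (eq_maxrowsub B).
    have -> : x + a0 = row (enum_rank_in xA x) B.
      by apply/rowP => j; rewrite [RHS]mxE [RHS]mxE enum_rankK_in.
    exact: row_sub.
  case/submxP => u e; exists u; by rewrite /phi -e addvK.
pose A' := phi @^-1: A.
have AE : A = phi @: A'.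
  apply/setP => x; apply/idP/imsetP => [xA|[u uA' ->]]; last by rewrite inE in uA'.
  by have [u xu] := cover x xA; exists u; rewrite // inE -xu.
have cA : #|A| = #|A'| by have := card_imset (mem A') phi_inj; rewrite -AE.
have span_le := card_affine_span_le An0 cover.
have sum_le : (#|msum A' A'| <= #|sumset A|)%N.
  rewrite -(card_imset _ (row_free_inj (maxrowsub_free B))).
  apply: subset_leq_card; apply/subsetP => _ /imsetP[_ /msumP[u [v [uA vA ->]]] ->].
  rewrite !inE in uA vA.
  have -> : (u + v) *m M = phi u + phi v.
    by rewrite mulmxDl /phi addrACA addvv addr0.
  exact: mem_msum.
have := @basis_spanning_bound _ A' s; rewrite -cA => H.
apply: leq_trans (H _ _ _); first by rewrite leq_mul2l span_le orbT.
- by rewrite inE /phi mul0mx add0r.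
- move=> i; rewrite inE /phi unit_vecE -rowE row_rowsub rowK addvK.
  exact: enum_valP.
- by apply: leq_trans doubling; rewrite leq_mul2l.
Qed.

(** * The extremal example *)

Definition simplex n : {set 'rV['F_2]_n} := 0 |: [set unit_vec i | i : 'I_n].

Lemma card_simplex n : #|simplex n| = n.+1.
Proof.
rewrite cardsU1 card_imset ?card_ord; last exact: unit_vec_inj.
case: imsetP => // -[i _ e].
by have := unit_vec_neq0 i; rewrite -e eqxx.
Qed.

(** Since x + x = 0, every nonzero sum comes from an unordered pair of distinct
    elements. *)
Lemma card_sumset_simplex n : (#|sumset (simplex n)| <= 1 + 'C(n.+1, 2))%N.
Proof.
pose pairs := [set D : {set 'rV['F_2]_n} | D \subset simplex n & #|D| == 2].
have cp : #|pairs| = 'C(n.+1, 2) by rewrite cards_draws card_simplex.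
have : sumset (simplex n) \subset 0 |: [set \sum_(x in D) x | D : {set 'rV['F_2]_n} in pairs].
  apply/subsetP => _ /msumP[u [v [uB vB ->]]]; rewrite in_setU1.
  have [->|uv] := eqVneq u v; first by rewrite addvv eqxx.
  apply/orP; right; apply/imsetP; exists [set u; v].
    by rewrite inE subUset !sub1set uB vB cards2 uv.
  by rewrite big_setU1 ?inE //= big_set1.
move/subset_leq_card/leq_trans; apply; rewrite cardsU1 leq_add ?leq_b1 //.
by rewrite -cp leq_imset_card.
Qed.

Lemma affine_span_simplex n : affine_span (simplex n) = setT.
Proof.
have B0 : simplex n != set0 by apply/set0Pn; exists 0; rewrite !inE eqxx.
have [/existsP[H /rcosetsP[a _ ->]] sub _] := affine_spanP B0.
have H0 : 0 \in (H :* a)%g by apply: (subsetP sub); rewrite !inE eqxx.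
have eH : (H :* a)%g = H by rewrite -(rcoset_eqP H0) mulg1.
apply/setP => x; rewrite inE eH.
rewrite (row_sum_delta x).
elim/big_ind: _ => [|y z yH zH|i _]; [exact: group1 | exact: groupM |].
have [xi|xi] := eqVneq (x 0 i) 0; first by rewrite xi scale0r; exact: group1.
have -> : x 0 i = 1 by move: (x 0 i) xi; case=> [[|[|//]] ?] //= _; apply/val_inj.
rewrite scale1r -unit_vecE -eH; apply: (subsetP sub); rewrite !inE.
by apply/orP; right; apply: imset_f.
Qed.

From mathcomp Require Import all_classical all_reals all_analysis.
Import numFieldNormedType.Exports.
Local Open Scope classical_set_scope.
Local Open Scope ring_scope.

(** * Asymptotics of F *)

Section SpanningConstant.
Variable R : realType.
Implicit Types (K : R) (s : nat).

Lemma F_le K s : (5 < s)%N -> 2 * K <= s%:R + 1 ->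
  (F K <= (2 ^+ s / (s%:R - 5))%:E)%E.
Proof.
move=> s5 Ks; apply: ge_ereal_sup => _ [n [A [A0 AK ->]]].
have s5R : 0 < s%:R - 5 :> R by rewrite subr_gt0 (ltr_nat _ 5).
have cA : 0 < #|A|%:R :> R by rewrite ltr0n card_gt0.
rewrite lee_fin ler_pdivlMr // mulrAC ler_pdivrMr // mulrC.
have doubling : (2 * #|sumset A| <= s.+1 * #|A|)%N.
  rewrite -(ler_nat R) !natrM -natr1; rewrite ler_pdivrMr // in AK.
  have : 2 * K * #|A|%:R <= (s%:R + 1) * #|A|%:R by rewrite ler_pM2r.
  by lra.
have := spanning_bound A0 doubling.
by rewrite -(ler_nat R) !natrM natrX natrB 1?ltnW // mulrC.
Qed.

Lemma F_ge K s : s%:R / 2 + 1 / (s%:R + 1) <= K ->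
  ((2 ^+ s / (s%:R + 1))%:E <= F K)%E.
Proof.
move=> Ks; apply: ereal_sup_ubound; exists s, (simplex s); split.
- by apply/finset.set0Pn; exists 0; rewrite !inE eqxx.
- apply: le_trans Ks; rewrite card_simplex.
  have s0 : 0 < s%:R + 1 :> R by rewrite natr1 ltr0n.
  rewrite ler_pdivrMr ?ltr0n // -[s.+1%:R]natr1 mulrDl divfK ?gt_eqF //.
  have binE : 2 * ('C(s.+1, 2))%:R = (s%:R + 1) * s%:R :> R.
    by rewrite -natrM -(mul_bin_diag s.+1 1) bin1 natrM natr1.
  have := card_sumset_simplex s; rewrite -(ler_nat R) natrD; lra.
- by rewrite affine_span_simplex cardsT card_mx card_Fp // mul1n natrX card_simplex natr1.
Qed.

Lemma pow2_ge x : 0 <= x -> 1 - x <= 2 `^ (- x) :> R.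
Proof.
move=> x0; rewrite /powR pnatr_eq0 /=; apply: le_trans (expR_ge1Dx _).
have : ln 2 <= 1 :> R by have := @le_ln1Dx R 1; rewrite -[1 + 1]/2; apply; lra.
by move=> ln2; have := ler_wpM2l x0 ln2; lra.
Qed.

Lemma pow2D (x y : R) : 2 `^ (x + y) = 2 `^ x * 2 `^ y.
Proof. by rewrite powRD // pnatr_eq0 implybT. Qed.

Lemma pow2n s : 2 `^ s%:R = 2 ^+ s :> R.
Proof. by rewrite powR_mulrn. Qed.

Lemma pow2_le (x y : R) : x <= y -> 2 `^ x <= 2 `^ y.
Proof. by apply: ler_powR; lra. Qed.

Lemma F_upper K : 8 <= K ->
  (F K <= ((1 / (2 * K)) * 2 `^ (2 * K) * (1 - (- 6 / K)))%:E)%E.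
Proof.
(* The choice s <= 2K < s + 1 is the smallest s with 2K <= s + 1, up to ties. *)
move=> K8; pose s := Num.truncn (2 * K).
have /andP[s1 s2] : s%:R <= 2 * K < s.+1%:R by apply: truncn_itv; lra.
rewrite -[s.+1%:R]natr1 in s2.
have s5 : (5 < s)%N by rewrite -(ltr_nat R); lra.
apply: le_trans (F_le s5 (ltW s2)) _; rewrite lee_fin.
have powle : 2 ^+ s <= 2 `^ (2 * K) by rewrite -pow2n pow2_le.
have p0 : 0 < 2 ^+ s :> R by apply: exprn_gt0.
apply: (@le_trans _ _ (2 `^ (2 * K) / (2 * K - 6))).
  apply: ler_pM => //; first by rewrite invr_ge0; lra.
  by rewrite lef_pV2 ?posrE; lra.
rewrite [1 / _ * _]mulrC -mulrA; apply: ler_wpM2l; first exact: powR_ge0.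
rewrite -[(2 * K - 6)^-1]mul1r ler_pdivrMr; last by lra.
have -> : 1 / (2 * K) * (1 - - 6 / K) * (2 * K - 6) = 1 + (3 * K - 18) / K ^+ 2.
  by field; lra.
by rewrite lerDl; apply: divr_ge0; [lra | apply: exprn_ge0; lra].
Qed.

Lemma F_lower K : 3 <= K ->
  (((1 / (4 * K)) * 2 `^ (2 * K) * (1 - 3 / K))%:E <= F K)%E.
Proof.
(* The shift by 2/K pays for the term 1/(s + 1) in [F_ge]; its cost is a factor
   2^(-2/K) >= 1 - 2/K. *)
move=> K3; pose s := Num.truncn (2 * K - 2 / K).
have iK : 0 < K^-1 by rewrite invr_gt0; lra.
have iK1 : K * K^-1 = 1 by rewrite mulfV //; lra.
have iK2 : K^-1 <= 1 by rewrite -[K^-1]mul1r ler_pdivrMr; lra.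
have /andP[s1 s2] : s%:R <= 2 * K - 2 / K < s.+1%:R by apply: truncn_itv; lra.
rewrite -[s.+1%:R]natr1 in s2.
have sK : s%:R / 2 + 1 / (s%:R + 1) <= K.
  have : 1 / (s%:R + 1) <= 1 / K.
    by rewrite !mul1r lef_pV2 ?posrE; lra.
  by lra.
apply: le_trans (F_ge sK); rewrite lee_fin.
have sp : 0 < s%:R + 1 :> R by lra.
have powle : 2 `^ (2 * K) * (1 - 2 / K) / 2 <= 2 ^+ s.
  rewrite ler_pdivrMr // -exprSr -pow2n -natr1.
  apply: (@le_trans _ _ (2 `^ (2 * K - 2 / K))); last by apply: pow2_le; lra.
  rewrite pow2D; apply: ler_wpM2l; first exact: powR_ge0.
  by apply: pow2_ge; apply: divr_ge0; lra.
rewrite ler_pdivlMr //; apply: le_trans powle.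
rewrite [1 / _ * _]mulrC -!mulrA; apply: ler_wpM2l; first exact: powR_ge0.
have : (1 - 3 / K) * (s%:R + 1) <= (1 - 3 / K) * (2 * K + 1).
  by apply: ler_wpM2l; nra.
have -> : (1 - 3 / K) * (2 * K + 1) = 2 * K - 5 - 3 / K by field; lra.
move=> h.
rewrite [leLHS](_ : _ = (1 - 3 / K) * (s%:R + 1) / (4 * K)); last by field; lra.
rewrite ler_pdivrMr; last lra.
have -> : (1 - 2 / K) * 2^-1 * (4 * K) = 2 * K - 4 by field; lra.
lra.
Qed.

(** The limit inferior is treated by applying this to the opposite function. *)
Lemma limf_esup_pinfty (f : R -> \bar R) (c C : R) : 0 <= C ->
  (\forall K \near +oo, (f K <= (c + C / K)%:E)%E) ->
  (forall M : R, exists2 K, M < K & ((c - C / K)%:E <= f K)%E) ->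
  limf_esup f +oo = c%:E.
Proof.
move=> C0 [M0 [_ upper]] lower; rewrite limf_esupE.
have small (e K : R) : 0 < e -> 0 < K -> C / e <= K -> C / K <= e.
  by move=> e0 K0; rewrite !ler_pdivrMr // mulrC.
apply/eqP; rewrite eq_le; apply/andP; split.
  apply/lee_addgt0Pr => e e0; apply: ge_ereal_inf.
  pose M := Num.max 1 (Num.max M0 (C / e)).
  exists (ereal_sup (f @` [set K | M < K])).
    by exists [set K | M < K] => //; exists M; rewrite num_real.
  apply: ge_ereal_sup => _ [K /= + <-].
  rewrite !gt_max => /and3P[K1 KM0 KC].
  apply: le_trans (upper K KM0) _; rewrite lee_fin lerD2l.
  by apply: small => //; [apply: lt_trans K1 | apply: ltW].
apply: le_ereal_inf_tmp => _ [V [M [_ MV]] <-].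
apply/lee_addgt0Pr => e e0.
have [K] := lower (Num.max 1 (Num.max M (C / e))).
rewrite !gt_max => /and3P[K1 KM KC] fK.
apply: (@le_trans _ _ (f K + e%:E)%E); last first.
  by rewrite leeD2r // ereal_sup_ubound //; exists K => //; apply: MV.
apply: le_trans (leeD2r _ fK); rewrite -EFinD lee_fin.
have := small e K e0 (lt_trans ltr01 K1) (ltW KC); lra.
Qed.

Lemma cvg_div_pinfty (c : R) : c / K @[K --> +oo] --> (0 : R).
Proof.
rewrite -[X in _ --> X](mulr0 c); apply: cvgMr.
have pos : \forall K \near +oo, 0 < (K : R) by exact: nbhs_pinfty_gt.
by apply/(gtr0_cvgV0 pos); exact: cvg_id.
Qed.

Lemma pow2N_K (x : R) : 2 `^ x * 2 `^ (- x) = 1.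
Proof. by rewrite -pow2D subrr powRr0. Qed.

(** This is the right end of the range where [spanning_bound] bounds F by about
    2^s / s, so 2^(2K) = 2^(s + 1) is as large as possible. *)
Lemma F_scaled_le K s : (9 < s)%N -> K = (s%:R + 1) / 2 ->
  (F K * (K * 2 `^ (- (2 * K)))%:E <= (1 / 4 + 2 / K)%:E)%E.
Proof.
move=> s9 KE; have s9R : 10 <= s%:R :> R by rewrite (ler_nat _ 10).
have K5 : 5 < K by lra.
have s5 : (5 < s)%N by apply: ltn_trans s9.
have Kp : 0 <= K * 2 `^ (- (2 * K)) by apply: mulr_ge0; [lra | apply: powR_ge0].
have sK : 2 * K <= s%:R + 1 by lra.
apply: le_trans (lee_wpmul2r _ (F_le s5 sK)) _; first by rewrite lee_fin.
rewrite -EFinM lee_fin.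
have -> : 2 `^ (- (2 * K)) = (2 ^+ s)^-1 / 2 :> R.
  by rewrite powRN (_ : 2 * K = s.+1%:R) ?pow2n ?exprS ?invfM 1?mulrC // -natr1; lra.
have p0 : 2 ^+ s != 0 :> R by rewrite expf_neq0.
have -> : 2 ^+ s / (s%:R - 5) * (K * ((2 ^+ s)^-1 / 2)) = K / (2 * (2 * K - 6)).
  by rewrite KE; field; rewrite p0 /=; apply/andP; split; lra.
rewrite ler_pdivrMr; last lra.
have -> : (1 / 4 + 2 / K) * (2 * (2 * K - 6)) = K + (5 - 24 / K) by field; lra.
by rewrite lerDl subr_ge0 ler_pdivrMr; lra.
Qed.

(** At the doubling constant of the simplex in dimension s, 2^(2K) exceeds 2^s
    only by the factor 2^(2/(s + 1)). *)
Lemma F_scaled_ge K s : (0 < s)%N -> K = s%:R / 2 + 1 / (s%:R + 1) ->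
  ((1 / 2 - 1 / K)%:E <= F K * (K * 2 `^ (- (2 * K)))%:E)%E.
Proof.
move=> s0 KE; have s1R : 1 <= s%:R :> R by rewrite (ler_nat _ 1).
set x : R := (s%:R + 1)^-1.
have sx : (s%:R + 1) * x = 1 by rewrite /x mulfV //; lra.
have x0 : 0 < x by rewrite invr_gt0; lra.
have x2 : x <= 1 / 2 by rewrite /x div1r lef_pV2 ?posrE; lra.
rewrite div1r -/x in KE.
have K0 : 0 < K by lra.
have Kp : 0 <= K * 2 `^ (- (2 * K)) by apply: mulr_ge0; [lra | apply: powR_ge0].
have sK : s%:R / 2 + 1 / (s%:R + 1) <= K by rewrite div1r -/x KE.
apply: le_trans (lee_wpmul2r _ (F_ge sK)); last by rewrite lee_fin.
rewrite -EFinM lee_fin.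
have -> : 2 `^ (- (2 * K)) = (2 ^+ s)^-1 * 2 `^ (- (2 * x)) :> R.
  by rewrite -pow2n -powRN -pow2D KE; congr (_ `^ _); lra.
have p0 : 2 ^+ s != 0 :> R by rewrite expf_neq0.
have -> : 2 ^+ s / (s%:R + 1) * (K * ((2 ^+ s)^-1 * 2 `^ (- (2 * x)))) =
    K * x * 2 `^ (- (2 * x)) :> R.
  by rewrite /x; field; rewrite p0 /=; lra.
apply: (@le_trans _ _ (K * x * (1 - 2 * x))); last first.
  by apply: ler_wpM2l; [apply: mulr_ge0; lra | apply: pow2_ge; lra].
have iK : 2 * x <= 1 / K.
  rewrite ler_pdivlMr //; nra.
nra.
Qed.

End SpanningConstant.

Theorem corollary13 (R : realType) :
  (exists e : R -> R,
     e K @[K --> +oo] --> (0 : R) /\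
     \forall K \near +oo,
       (((1 / (4 * (K : R))) * 2 `^ (2 * K) * (1 - e K))%:E <= F K)%E) /\
  (exists e : R -> R,
     e K @[K --> +oo] --> (0 : R) /\
     \forall K \near +oo,
       (F K <= ((1 / (2 * K)) * 2 `^ (2 * K) * (1 - e K))%:E)%E) /\
  limf_einf (fun K : R => (F K * (K * 2 `^ (- (2 * K)))%:E)%E) +oo
    = (1 / 4)%:E /\
  limf_esup (fun K : R => (F K * (K * 2 `^ (- (2 * K)))%:E)%E) +oo
    = (1 / 2)%:E.
Proof.
have large (c : R) : \forall K \near +oo, c <= (K : R).
  by apply: nbhs_pinfty_ge; exact: num_real.
have scale (K : R) : 0 < K -> 0 <= K * 2 `^ (- (2 * K)).
  by move=> K0; apply: mulr_ge0; [exact: ltW | exact: powR_ge0].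
have scaled (c d K : R) : 0 < K -> 0 < c ->
    1 / (c * K) * 2 `^ (2 * K) * d * (K * 2 `^ (- (2 * K))) = d / c.
  move=> K0 c0; rewrite (_ : _ * _ = 1 / (c * K) * K * d *
    (2 `^ (2 * K) * 2 `^ (- (2 * K)))); last by ring.
  by rewrite pow2N_K; field; rewrite !gt_eqF.
have upper : \forall K \near +oo,
    (F K * (K * 2 `^ (- (2 * K)))%:E <= (1 / 2 + 3 / K)%:E :> \bar R)%E.
  near=> K; have K8 : 8 <= K by near: K.
  have K0 : 0 < K by apply: lt_le_trans K8.
  apply: le_trans (lee_wpmul2r _ (F_upper K8)) _; first by rewrite lee_fin scale.
  by rewrite -EFinM lee_fin scaled //; lra.
have lower : \forall K \near +oo,
    ((1 / 4 - 2 / K)%:E <= F K * (K * 2 `^ (- (2 * K)))%:E :> \bar R)%E.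
  near=> K; have K8 : 3 <= K by near: K.
  have K0 : 0 < K by apply: lt_le_trans K8.
  apply: le_trans (lee_wpmul2r _ (F_lower K8)); last by rewrite lee_fin scale.
  rewrite -EFinM lee_fin scaled //.
  have : 0 < K^-1 by rewrite invr_gt0.
  lra.
have beyond (k : nat) (M : R) : exists2 s, (k < s)%N & 2 * M < s%:R.
  exists (Num.truncn (2 * `|M|) + k.+1)%N; first by rewrite addnS ltnS leq_addl.
  have M0 : 0 <= 2 * `|M| by apply: mulr_ge0.
  have /andP[_] := truncn_itv M0.
  rewrite natrD -[_.+1%:R]natr1; have := ler_norm M; have := ler0n R k.
  by rewrite -[k.+1%:R]natr1; lra.
split; [|split; [|split]].
- exists (fun K => 3 / K); split; first exact: cvg_div_pinfty.
  by near=> K; apply: F_lower; near: K.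
- exists (fun K => - 6 / K); split; first exact: cvg_div_pinfty.
  by near=> K; apply: F_upper; near: K.
- rewrite /limf_einf (@limf_esup_pinfty _ _ (- (1 / 4)) 2) ?EFinN ?oppeK //.
    near=> K; rewrite leeNl -EFinN opprD opprK.
    by near: K.
  move=> M; have [s s9 sM] := beyond 9 M.
  exists ((s%:R + 1) / 2); first by lra.
  rewrite leeNr -EFinN opprD !opprK.
  exact: (F_scaled_le s9).
- apply: (@limf_esup_pinfty _ _ _ 3) => // M.
  have [s s0 sM] := beyond 0 M.
  have x0 : 0 < 1 / (s%:R + 1) :> R by rewrite div1r invr_gt0 natr1 ltr0n.
  exists (s%:R / 2 + 1 / (s%:R + 1)); first by lra.
  set K := s%:R / 2 + _; apply: le_trans (F_scaled_ge s0 (erefl K)).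
  rewrite lee_fin; have : 0 < K^-1 by rewrite invr_gt0 addr_gt0 // divr_gt0 // ltr0n.
  by lra.
Unshelve. all: by end_near.
Qed.
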